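(* Let $X_1, X_2, \dots$ be i.i.d. random variables with the exponential distribution with density $f(x)=\lambda e^{-\lambda x}$, $x\ge 0$, for some $\lambda>0$. For $n\ge 2$ let $F_n(t)=n^{-1}\sum_{i=1}^n \mathbf{1}\{X_i<t\}$ be the empirical distribution function of $X_1,\dots,X_n$, let $$H_n(t)=\binom{n}{2}^{-1}\sum_{1\le i<j\le n}\mathbf{1}\{2\min(X_i,X_j)<t\},\qquad t\ge 0,$$ and let $$I_n=\int_0^\infty \big(F_n(t)-H_n(t)\big)\,dF_n(t).$$ Then, as $n\to\infty$, $$\sqrt{n}\, I_n \xrightarrow{d} \mathcal{N}(0,9\Delta^2),\qquad \text{where } \Delta^2=\frac{11}{3780},$$ i.e. the limiting normal distribution has mean $0$ and variance $9\cdot\frac{11}{3780}=\frac{11}{420}$.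
   Context: $\Delta^2$ is the variance of the projection $\psi(s)=\frac13 e^{-s}-\frac1{18}-\frac49 e^{-3s}$ (taken under the standard exponential law) of the centered degree-3 kernel $\Psi(X,Y,Z)=\frac12-\frac13\big[\mathbf{1}\{2\min(X,Y)<Z\}+\mathbf{1}\{2\min(Y,Z)<X\}+\mathbf{1}\{2\min(X,Z)<Y\}\big]$, to whose $U$-statistic $I_n$ is asymptotically equivalent; the distribution of $I_n$ does not depend on $\lambda$. *)

(* Defs.v *)
From HB Require Import structures.
From mathcomp Require Import all_boot all_order all_algebra.
From mathcomp Require Import all_classical all_reals all_analysis.
Set Implicit Arguments. Unset Strict Implicit. Unset Printing Implicit Defensive.
Import Order.TTheory GRing.Theory Num.Theory.
Import numFieldTopology.Exports.
Local Open Scope classical_set_scope.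
Local Open Scope ring_scope.

Section defs.
Context {d : measure_display} {T : measurableType d} {R : realType}.
Variable P : probability T R.

(** Mutual independence of the sequence (X i)_i : for every n and every
    family of Borel sets B, P(X_0 in B_0, ..., X_{n-1} in B_{n-1}) is the
    product of the marginal probabilities (taking B_i = setT for unused
    indices gives the product rule over every finite subfamily). *)
Definition mutually_independent (X : nat -> {RV P >-> R}) : Prop :=
  forall (n : nat) (B : nat -> set R), (forall i, measurable (B i)) ->
    P (\bigcap_(i in `I_n) (X i @^-1` B i)) =
    (\prod_(i < n) P (X i @^-1` B i))%E.

Definition exp_distributed (lam : R) (Y : {RV P >-> R}) : Prop :=
  forall A : set R, measurable A -> P (Y @^-1` A) = exponential_prob lam A.

Definition conv_in_distribution (Y : nat -> T -> R)
    (mu : set R -> \bar R) : Prop :=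
  forall x : R, {for x, continuous (fun y : R => fine (mu [set` `]-oo, y]]))} ->
    (fun n => P [set w | Y n w <= x]) @ \oo --> mu [set` `]-oo, x]].
End defs.

(** Empirical distribution function of X_1..X_n (indexed 0..n-1 here). *)
Definition Fn {T : Type} {R : realType} (X : nat -> T -> R) (n : nat)
    (w : T) (t : R) : R :=
  n%:R^-1 * \sum_(i < n) (X i w < t)%R%:R.

Definition Hn {T : Type} {R : realType} (X : nat -> T -> R) (n : nat)
    (w : T) (t : R) : R :=
  ('C(n, 2))%:R^-1 *
    \sum_(i < n) \sum_(j < n | (i < j)%N) (2 * Num.min (X i w) (X j w) < t)%R%:R.

(** I_n = int_0^oo (F_n - H_n) dF_n ; dF_n is the empirical measure putting
    mass 1/n at each X_k (all X_k >= 0 a.s.), so the integral is the average. *)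
Definition In {T : Type} {R : realType} (X : nat -> T -> R) (n : nat)
    (w : T) : R :=
  n%:R^-1 * \sum_(k < n) (Fn X n w (X k w) - Hn X n w (X k w)).

Definition Delta2 {R : realType} : R := 11%:R / 3780%:R.

(* Main.v *)
Require Import Defs.
From HB Require Import structures.
From mathcomp Require Import all_boot all_order all_algebra.
From mathcomp Require Import all_classical all_reals all_analysis.
From mathcomp Require Import measurable_realfun ring lra.
Set Implicit Arguments. Unset Strict Implicit. Unset Printing Implicit Defensive.
Import Order.TTheory GRing.Theory Num.Theory.
Import numFieldNormedType.Exports.
Local Open Scope classical_set_scope.
Local Open Scope ring_scope.

(** Since [2 min(x, y) < z] fails iff [z <= 2 x] and [z <= 2 y], [I_n] is, up to
    ties and terms of order [1/n], a quadratic functional of the counts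
    [Q_k = #{i | X_k <= 2 X_i}].  Centering [1{z <= 2 x}] at its conditional mean
    [G z = P(2 X >= z)] and projecting the remaining bilinear term on one variable
    gives [sqrt n I_n = n^(-1/2) sum_k phi (X_k) + O_{L1}(n^(-1/2))]: the error is
    made of degenerate sums whose second moments are bounded by orthogonality.
    Here [phi s = e^(-lam s) - 1/6 - 4/3 e^(-3 lam s)], which has variance 11/420.

    The central limit theorem for the bounded variables [phi (X_k)] is proved
    without characteristic functions: if [F] is the cdf of N(0, s^2), then
    [u (t, b) = F (b / sqrt t)] solves the heat equation [u_t = s^2/2 u_bb], so
    replacing one summand by a time increment [1/n] costs [O(n^(-3/2))] and
    telescoping yields [E F ((a - W_n) / e) -> F (a / sqrt (1 + e^2))].  Small [e]
    sandwiches the indicator of a half-line between such smooth functions. *)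

(** * Bounded measurable functions *)

(** Every random quantity below is bounded, so integrability reduces to closure of [bounded_mfun]
    under the operations used, and the real-valued integral is linear without side conditions on
    convergence. Independence enters only through [exp_indep]: one variable is integrated out while
    a function of the others is frozen. This serves the telescoping of the central limit theorem,
    the vanishing of mixed moments of degenerate sums, and the absence of ties. The function [phi]
    arises as G^2 + 2 b - 1/2, where b (x) is the mean over z of G (z) (1{z <= 2 x} - G (z)). Here
    G^2 is the effect of a point as comparison value, 2 b its effect as one of the two members of
    the minimum, and -1/2 = 1/2 - 1 collects the mean of [Fn] and the constant term of [Hn]. It is 3
    psi (lam s), three being the degree of the kernel Psi, hence the variance 9 Delta^2. Heat-flow
    times stay above e^2 because the derivatives of F (b / sqrt t) in b blow up as t tends to 0; e
    is fixed before n grows. *)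

Definition bounded_mfun d (T : measurableType d) (R : realType) (f : T -> R) :=
  measurable_fun [set: T] f /\ exists M, forall x, `|f x| <= M.

Section bounded_mfun_theory.
Context d (T : measurableType d) (R : realType).
Implicit Types f g : T -> R.

Lemma bmfun_cst (r : R) : bounded_mfun (fun _ : T => r).
Proof. by split => //; exists `|r|. Qed.

Lemma bmfunD f g : bounded_mfun f -> bounded_mfun g ->
  bounded_mfun (fun x => f x + g x).
Proof.
move=> [mf [M fM]] [mg [N gN]]; split; first exact: measurable_funD.
by exists (M + N) => x; rewrite (le_trans (ler_normD _ _))// lerD.
Qed.

Lemma bmfunM f g : bounded_mfun f -> bounded_mfun g ->
  bounded_mfun (fun x => f x * g x).
Proof.
move=> [mf [M fM]] [mg [N gN]]; split; first exact: measurable_funM.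
by exists (M * N) => x; rewrite normrM ler_pM.
Qed.

Lemma bmfunN f : bounded_mfun f -> bounded_mfun (fun x => - f x).
Proof.
move=> [mf [M fM]]; split; first exact: measurableT_comp.
by exists M => x; rewrite normrN.
Qed.

Lemma bmfunB f g : bounded_mfun f -> bounded_mfun g ->
  bounded_mfun (fun x => f x - g x).
Proof. by move=> bf bg; apply: bmfunD => //; exact: bmfunN. Qed.

Lemma bmfunX f n : bounded_mfun f -> bounded_mfun (fun x => f x ^+ n).
Proof.
move=> [mf [M fM]]; split; first exact: measurable_funX.
by exists (M ^+ n) => x; rewrite normrX lerXn2r// nnegrE// (le_trans _ (fM x)).
Qed.

Lemma bmfun_norm f : bounded_mfun f -> bounded_mfun (fun x => `|f x|).
Proof.
move=> [mf [M fM]]; split; first exact: measurableT_comp.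
by exists M => x; rewrite normr_id.
Qed.

Lemma bmfun_sum (I : Type) (s : seq I) (Q : pred I) (F : I -> T -> R) :
  (forall i, bounded_mfun (F i)) -> bounded_mfun (fun x => \sum_(i <- s | Q i) F i x).
Proof.
move=> bF; elim: s => [|i s IH].
  by under eq_fun do rewrite big_nil; exact: bmfun_cst.
under eq_fun do rewrite big_cons.
by case: (Q i) => //; exact: bmfunD.
Qed.

Lemma bmfun_comp d' (T' : measurableType d') (h : T' -> T) f :
  measurable_fun [set: T'] h -> bounded_mfun f -> bounded_mfun (fun x => f (h x)).
Proof.
by move=> mh [mf [M fM]]; split; [exact: measurableT_comp|exists M].
Qed.

Lemma bmfun_bool (b : T -> bool) : measurable_fun [set: T] b ->
  bounded_mfun (fun x => (b x)%:R : R).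
Proof.
move=> mb; split; last by exists 1 => x; case: (b x); rewrite ?normr1 ?normr0.
apply: (@measurableT_comp _ _ _ _ _ _ (fun b : bool => b%:R : R)) => //.
Qed.

End bounded_mfun_theory.

(** * Expectation of bounded functions *)

Section expectation.
Context d (T : measurableType d) (R : realType) (P : probability T R).
Implicit Types f g : T -> R.

Lemma bmfun_integrable f : bounded_mfun f -> P.-integrable setT (EFin \o f).
Proof.
move=> [mf [M fM]]; apply: measurable_bounded_integrable => //.
  by rewrite (le_lt_trans (@probability_le1 _ _ _ P _ _))// ltry.
exists M; split; rewrite ?num_real// => x Mx y _ /=.
by rewrite (le_trans (fM y))// ltW.
Qed.

Lemma expZ f (r : R) : bounded_mfun f -> \int[P]_w (r * f w) = r * \int[P]_w f w.
Proof. by move=> bf; rewrite RintegralZl//; exact: bmfun_integrable. Qed.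

Lemma expD f g : bounded_mfun f -> bounded_mfun g ->
  \int[P]_w (f w + g w) = \int[P]_w f w + \int[P]_w g w.
Proof. by move=> bf bg; rewrite RintegralD//; exact: bmfun_integrable. Qed.

Lemma expB f g : bounded_mfun f -> bounded_mfun g ->
  \int[P]_w (f w - g w) = \int[P]_w f w - \int[P]_w g w.
Proof. by move=> bf bg; rewrite RintegralB//; exact: bmfun_integrable. Qed.

Lemma exp_cst (r : R) : \int[P]_w r = r.
Proof. by rewrite Rintegral_cst//= probability_setT mulr1. Qed.

Lemma exp_sum (I : Type) (s : seq I) (Q : pred I) (F : I -> T -> R) :
  (forall i, bounded_mfun (F i)) ->
  \int[P]_w (\sum_(i <- s | Q i) F i w) = \sum_(i <- s | Q i) \int[P]_w F i w.
Proof.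
move=> bF; elim: s => [|i s IH].
  by rewrite big_nil; under eq_Rintegral do rewrite big_nil; rewrite exp_cst.
rewrite big_cons -IH; case: ifPn => Qi.
  under eq_Rintegral do rewrite big_cons Qi.
  by rewrite expD//; exact: bmfun_sum.
by under eq_Rintegral do rewrite big_cons (negbTE Qi).
Qed.

Lemma exp_le f g : bounded_mfun f -> bounded_mfun g ->
  (forall w, f w <= g w) -> \int[P]_w f w <= \int[P]_w g w.
Proof. by move=> bf bg fg; apply: le_Rintegral => //; exact: bmfun_integrable. Qed.

Lemma exp_normr f : bounded_mfun f -> `|\int[P]_w f w| <= \int[P]_w `|f w|.
Proof. by move=> bf; apply: le_normr_Rintegral => //; exact: bmfun_integrable. Qed.

Lemma exp_le_cst f (M : R) : bounded_mfun f -> (forall w, f w <= M) ->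
  \int[P]_w f w <= M.
Proof.
by move=> bf fM; rewrite -[leRHS]exp_cst; apply: exp_le => //; exact: bmfun_cst.
Qed.

Lemma exp_normr_le f (M : R) : bounded_mfun f -> (forall w, `|f w| <= M) ->
  `|\int[P]_w f w| <= M.
Proof.
move=> bf fM; apply: le_trans (exp_normr bf) _.
by apply: exp_le_cst => //; exact: bmfun_norm.
Qed.

End expectation.

(** * Integrals depending on a parameter *)

Section parameter_integral.
Context d (T : measurableType d) d' (S : measurableType d') (R : realType).
Variable P : probability T R.

Lemma bmfun_section (g : T * S -> R) (y : S) : bounded_mfun g ->
  bounded_mfun (fun x => g (x, y)).
Proof.
move=> bg; apply: bmfun_comp bg => /=.
exact: measurable_pair2.
Qed.

Lemma bmfun_exp (g : T * S -> R) : bounded_mfun g ->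
  bounded_mfun (fun y => \int[P]_x g (x, y)).
Proof.
move=> bg; have [mg [M gM]] := bg; split; last first.
  exists M => y; apply: exp_normr_le => //; exact: bmfun_section.
suff : measurable_fun setT (fun y : S => \int[P]_x (g (x, y))%:E)%E.
  move=> h; exact: (measurableT_comp _ h).
(* Tonelli measurability is for nonnegative integrands: g is shifted by its bound M, and the
   constant is subtracted afterwards. *)
have -> : (fun y : S => \int[P]_x (g (x, y))%:E)%E =
  (fun y : S => \int[P]_x (g (x, y) + M)%:E - M%:E)%E.
  apply/funext => y.
  under [in RHS]eq_integral do rewrite EFinD.
  rewrite integralD//=; last 2 first.
    exact: (bmfun_integrable P (bmfun_section y bg)).
    exact: (bmfun_integrable P (bmfun_cst T M)).
  rewrite integral_cst//= [P _]probability_setT mule1 addeK//.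
apply: emeasurable_funB => //.
apply: (measurable_fun_fubini_tonelli_G (fun z => (g z + M)%:E)) => //.
  by apply/measurable_EFinP; exact: measurable_funD.
move=> z; rewrite lee_fin.
by have := gM z; rewrite ler_norml => /andP[]; lra.
Qed.

End parameter_integral.

(** * Independence *)

Section independence.
Context d (T : measurableType d) (R : realType) (P : probability T R).
Variable X : nat -> {RV P >-> R}.

(* Cylinders not constraining X v: a pi-system generating sigma(X j, j <> v). *)
Definition cylinders_off (v : nat) : set (set T) := [set C |
  exists B : nat -> set R, [/\ forall i, measurable (B i),
    exists n, forall i, (n <= i)%N -> B i = setT, B v = setT &
    C = \bigcap_i (X i @^-1` B i)]].

(** Says that [Y] depends only on the coordinates other than [v], without naming which ones or how
    many. *)
Definition measurable_off (v : nat) d' (S : measurableType d') (Y : T -> S) :=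
  measurable_fun [set: g_sigma_algebraType (cylinders_off v)]
    (Y : g_sigma_algebraType (cylinders_off v) -> S).

Lemma measurable_RV i (B : set R) : measurable B -> measurable (X i @^-1` B).
Proof. by move=> mB; rewrite -[_ @^-1` _]setTI; exact: measurable_funP. Qed.

Lemma cylinders_off_measurable v C : cylinders_off v C -> measurable C.
Proof.
move=> [B [mB _ _ ->]]; apply: bigcap_measurable; first by exists 0%N.
by move=> i _; exact: measurable_RV.
Qed.

Lemma cylinders_off_setI v : setI_closed (cylinders_off v).
Proof.
move=> _ _ [B [mB [n nB] vB ->]] [B' [mB' [n' nB'] vB' ->]].
exists (fun i => B i `&` B' i); split.
- by move=> i; exact: measurableI.
- exists (maxn n n') => i; rewrite geq_max => /andP[ni n'i].
  by rewrite nB// nB'// setIT.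
- by rewrite vB vB' setIT.
- by rewrite -bigcapI; apply: eq_bigcapr => i _; rewrite preimage_setI.
Qed.

Lemma measurable_off_RV v j : j != v -> measurable_off v (X j).
Proof.
move=> jv _ B mB; rewrite setTI; apply: sub_sigma_algebra.
exists (fun i => if i == j then B else setT); split.
- by move=> i; case: ifP.
- by exists j.+1 => i ji; rewrite gtn_eqF.
- by rewrite eq_sym (negbTE jv).
- rewrite eqEsubset; split=> w.
    by move=> Bw i _; rewrite /preimage/=; case: eqP => // ->.
  by move=> /(_ j I); rewrite /preimage/= eqxx.
Qed.

Lemma measurable_off_measurable v d' (S : measurableType d') (Y : T -> S) :
  measurable_off v Y -> measurable_fun setT Y.
Proof.
move=> mY _ B mB; have := mY measurableT B mB.
rewrite !setTI; set A := Y @^-1` B; move: A => A.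
apply: smallest_sub; first exact: sigma_algebra_measurable.
exact: cylinders_off_measurable.
Qed.

Hypothesis indepX : mutually_independent X.
Local Open Scope ereal_scope.

(** A cylinder that leaves coordinate [v] free constrains finitely many others; putting A into the
    free slot gives one finite product to which the product rule applies. *)
Lemma indep_cylinders_off v (A : set R) C : measurable A -> cylinders_off v C ->
  P ((X v @^-1` A) `&` C) = P (X v @^-1` A) * P C.
Proof.
move=> mA [B [mB [n nB] vB ->]].
(* m covers both the constrained coordinates and v itself, so both intersections over all indices
   are intersections over [I_m]. *)
pose m := maxn n v.+1.
have vm : (v < m)%N by rewrite leq_max leqnn orbT.
have bcapE (B' : nat -> set R) : (forall i, (m <= i)%N -> B' i = setT) ->
    \bigcap_i (X i @^-1` B' i) = \bigcap_(i in `I_m) (X i @^-1` B' i).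
  move=> mB'; rewrite eqEsubset; split=> w wB' i im; first exact: wB'.
  by have [im'|mi] := ltnP i m; [exact: wB'|rewrite mB'].
have mn i : (m <= i)%N -> (n <= i)%N by rewrite geq_max => /andP[].
pose B' i := if i == v then A else B i.
have mB' i : measurable (B' i) by rewrite /B'; case: ifP.
have -> : (X v @^-1` A) `&` \bigcap_i (X i @^-1` B i) =
    \bigcap_i (X i @^-1` B' i).
  rewrite eqEsubset; split=> w.
    by move=> [Aw Bw] i _; rewrite /B' /preimage/=; case: eqP => [->//|_]; exact: Bw.
  move=> Bw; split; first by have := Bw v I; rewrite /B' /preimage/= eqxx.
  move=> i _; have := Bw i I; rewrite /B' /preimage/=; case: eqP => [->|//].
  by rewrite vB.
rewrite !bcapE; last 2 first.
  by move=> i /mn /nB.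
  move=> i mi; rewrite /B' ifF ?(nB _ (mn _ mi))//.
  by rewrite gtn_eqF// (leq_trans vm).
rewrite !indepX// (bigD1 (Ordinal vm))//= [in RHS](bigD1 (Ordinal vm))//=.
rewrite /B' eqxx vB preimage_setT probability_setT mul1e; congr (_ * _).
by apply: eq_bigr => i iv; rewrite ifF//; apply/negbTE.
Qed.

(** Pi-lambda argument: for fixed A, the events satisfying the product rule form a lambda-system
    that contains the pi-system [cylinders_off v]. *)
Lemma indep_off v (A : set R) d' (S : measurableType d') (Y : T -> S) (B : set S) :
  measurable A -> measurable B -> measurable_off v Y ->
  P ((X v @^-1` A) `&` (Y @^-1` B)) = P (X v @^-1` A) * P (Y @^-1` B).
Proof.
move=> mA mB mY; have := mY measurableT B mB; rewrite setTI.
set E := Y @^-1` B => sE.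
pose Q : set (set T) := [set E | measurable E /\
  P ((X v @^-1` A) `&` E) = P (X v @^-1` A) * P E].
have mXA := measurable_RV v mA.
suff : <<s cylinders_off v >> `<=` Q by move=> /(_ _ sE)[].
apply: lambda_system_subset; last by [].
- exact: cylinders_off_setI.
- apply/dynkin_lambda_system; split.
  + by split => //; rewrite setIT probability_setT mule1.
  + move=> F [mF PF]; split; first exact: measurableC.
    rewrite -setDE measureD//; last by rewrite -ge0_fin_numE// fin_num_measure.
    transitivity (P (X v @^-1` A) - P (X v @^-1` A) * P F).
      by congr (_ - _); exact: PF.
    rewrite probability_setC// muleBr ?mule1//; first by rewrite fin_num_measure.
  + move=> F tF QF; have mF k : measurable (F k) by have [] := QF k.
    split; first exact: bigcup_measurable.
    rewrite setI_bigcupr measure_bigcup//; last 2 first.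
      by move=> k _; exact: measurableI.
      exact: trivIset_setIl.
    rewrite measure_bigcup//.
    transitivity (\sum_(0 <= k <oo | k \in setT) (P (X v @^-1` A) * P (F k))).
      by apply: eq_eseriesr => k _; exact: (QF k).2.
    by rewrite -[P (X v @^-1` A)]fineK ?fin_num_measure// nneseriesZl.
- by move=> C CC; split; [exact: cylinders_off_measurable CC|exact: indep_cylinders_off].
Qed.

(** The joint law of [X v] and [Y] agrees with the product law on rectangles, hence everywhere, and
    Fubini then integrates [X v] out first. *)
Lemma exp_indep v (mu : probability R R) d' (S : measurableType d') (Y : T -> S)
    (g : R * S -> R) :
  (forall A, measurable A -> P (X v @^-1` A) = mu A) ->
  measurable_off v Y -> bounded_mfun g ->
  (\int[P]_w g (X v w, Y w) = \int[P]_w \int[mu]_x g (x, Y w))%R.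
Proof.
move=> Xmu oY bg; have mY := measurable_off_measurable oY.
pose Ym : {mfun T >-> S} := HB.pack Y (isMeasurableFun.Build _ _ _ _ Y mY).
pose Z w : R * S := (X v w, Y w).
have mZ : measurable_fun setT Z by exact: measurable_fun_pair.
pose Zm : {mfun T >-> (R * S)%type} :=
  HB.pack Z (isMeasurableFun.Build _ _ _ _ Z mZ).
have [mg _] := bg.
have bgZ : bounded_mfun (fun w => g (Z w)) by exact: bmfun_comp mZ bg.
have muY : forall C, measurable C ->
    (mu \x distribution P Ym) C = distribution P Zm C.
  apply: product_measure_unique => A B mA mB.
  transitivity (P (X v @^-1` A) * P (Y @^-1` B)); last first.
    by congr (_ * _); exact: Xmu.
  exact: (indep_off mA mB oY).
rewrite /Rintegral; congr fine.
transitivity (\int[distribution P Zm]_z (g z)%:E).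
  rewrite /distribution integral_pushforward//; first exact/measurable_EFinP.
  exact: bmfun_integrable bgZ.
transitivity (\int[mu \x distribution P Ym]_z (g z)%:E).
  by apply/esym/eq_measure_integral => A mA _; exact: muY.
rewrite -(integral21_prod_meas1 (m1 := mu) (m2 := distribution P Ym))//; last first.
  exact: (@bmfun_integrable _ _ _ (mu \x distribution P Ym)%E _ bg).
have -> : fubini_G mu (fun z => (g z)%:E) =
    (fun y => (\int[mu]_x g (x, y))%:E)%R.
  apply/funext => y; rewrite /fubini_G/= fineK//.
  apply: integrable_fin_num => //; apply: bmfun_integrable.
  exact: bmfun_section.
have bG : bounded_mfun (fun y => \int[mu]_x g (x, y))%R by exact: bmfun_exp.
rewrite /distribution integral_pushforward//=.
  by apply/measurable_EFinP; exact: bG.1.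
by apply: bmfun_integrable; exact: bmfun_comp mY bG.
Qed.

End independence.

(** * Taylor bounds *)

Section taylor.
Context (R : realType).
Implicit Types f : R -> R.

(** The intermediate point is encoded as a fraction t of the increment, so that x and y may come in
    either order or coincide. *)
Lemma mean_value f (f1 : R -> R) : (forall x : R, is_derive x 1 f (f1 x)) ->
  forall x y, exists2 t, 0 <= t <= 1 & f y - f x = f1 (x + t * (y - x)) * (y - x).
Proof.
move=> df x y.
have cf a b : {within `[a, b], continuous f}.
  by apply: derivable_within_continuous => z _; exact: ex_derive.
have [->|yx] := eqVneq y x.
  by exists 0; rewrite ?lexx ?ler01// !subrr mulr0.
have yx0 : y - x != 0 by rewrite subr_eq0.
case: (ltrgtP x y) => xy; last by rewrite xy eqxx in yx.
- have [c cxy fE] := MVT xy (fun z _ => df z) (cf x y).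
  exists ((c - x) / (y - x)); last by rewrite divfK// [x + _]addrC subrK.
  move: cxy; rewrite in_itv/= => /andP[xc cy].
  by rewrite divr_ge0 ?ler_pdivrMr ?subr_gt0 ?mul1r ?lerD2r ?subr_ge0 ?ltW.
- have [c cxy fE] := MVT xy (fun z _ => df z) (cf y x).
  exists ((c - x) / (y - x)); last first.
    by rewrite divfK// [x + _]addrC subrK -[LHS]opprB fE -mulrN opprB.
  move: cxy; rewrite in_itv/= => /andP[yc cx].
  rewrite -mulrNN -invrN !opprB.
  by rewrite divr_ge0 ?ler_pdivrMr ?subr_gt0 ?mul1r ?lerD2l ?lerN2 ?subr_ge0 ?ltW.
Qed.

Lemma lipschitz_derive_bound f (f1 : R -> R) (L : R) :
  (forall x : R, is_derive x 1 f (f1 x)) -> (forall x, `|f1 x| <= L) ->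
  forall x y, `|f y - f x| <= L * `|y - x|.
Proof.
move=> df f1L x y; have [t _ ->] := mean_value df x y.
by rewrite normrM ler_wpM2r.
Qed.

(** Two applications of the mean value theorem, to the remainder as a function of the increment and
    then to [f1], followed by the Lipschitz bound on [f2]. The constant is L instead of the sharp L
    / 6, which is enough here. *)
Lemma taylor2_bound f (f1 f2 f3 : R -> R) (L : R) :
  (forall x : R, is_derive x 1 f (f1 x)) -> (forall x : R, is_derive x 1 f1 (f2 x)) ->
  (forall x : R, is_derive x 1 f2 (f3 x)) -> (forall x, `|f3 x| <= L) ->
  forall x h, `|f (x + h) - f x - h * f1 x - h ^+ 2 / 2 * f2 x| <= L * `|h| ^+ 3.
Proof.
move=> df df1 df2 f3L x h.
have L0 : 0 <= L by rewrite (le_trans _ (f3L 0)).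
pose phi k := f (x + k) - k * f1 x - k ^+ 2 / 2 * f2 x.
have dphi (k : R) : is_derive k 1 phi (f1 (x + k) - f1 x - k * f2 x).
  have dfx : is_derive k 1 (f \o shift x) (f1 (k + x)).
    have := @is_derive1_comp _ f (shift x) k (f1 (k + x)) 1 (df _) (is_derive_shift k 1 x).
    by rewrite mulr1.
  have -> : phi = (f \o shift x) - (f1 x *: id) - (f2 x / 2) *: (id ^+ 2) :> (R -> R).
    apply/funext => z; rewrite /phi /= !fctE/= [x + z]addrC /GRing.scale/=.
    by field.
  apply: is_derive_eq.
  rewrite /GRing.scale/= [x + k]addrC expr1 !mulr1.
  by field.
have [t /andP[t0 t1]] := mean_value dphi 0 h.
rewrite subr0 add0r {1 2}/phi addr0 !mul0r expr0n/= !mul0r !subr0.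
move=> phiE.
have -> : f (x + h) - f x - h * f1 x - h ^+ 2 / 2 * f2 x =
  f (x + h) - h * f1 x - h ^+ 2 / 2 * f2 x - f x by ring.
rewrite phiE normrM exprS mulrCA [leRHS]mulrC ler_wpM2r//.
have [t' /andP[t'0 t'1]] := mean_value df1 x (x + t * h).
have -> : x + t * h - x = t * h by ring.
move=> ->.
set z := (X in f2 X).
have -> : f2 z * (t * h) - t * h * f2 x = t * h * (f2 z - f2 x) by ring.
rewrite normrM.
have : `|f2 z - f2 x| <= L * `|z - x| by exact: lipschitz_derive_bound.
have -> : z - x = t' * (t * h) by rewrite /z; ring.
rewrite !normrM (ger0_norm t0) (ger0_norm t'0) => H.
have h0 : 0 <= `|h| by [].
have th : t * `|h| <= `|h| by rewrite ler_piMl.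
have th0 : 0 <= t * `|h| by exact: mulr_ge0.
apply: le_trans (_ : `|h| * (L * `|h|) <= _); last by rewrite expr2 mulrCA.
apply: ler_pM => //; apply: le_trans H _.
by rewrite ler_wpM2l// (le_trans _ th)// ler_piMl.
Qed.

End taylor.

(** * The normal cdf and its heat flow *)

Section normal_cdf.
Context (R : realType).
Variable s : R.
Hypothesis s_gt0 : 0 < s.
Let s_neq0 : s != 0. Proof. by rewrite gt_eqF. Qed.

Definition normal_cdf (y : R) : R := fine (normal_prob 0 s [set` `]-oo, y]]).

Local Notation p := (normal_pdf 0 s).
Local Notation F := normal_cdf.
Let p1 (z : R) := - (z / s ^+ 2) * p z.
Let p2 (z : R) := (z ^+ 2 / s ^+ 4 - (s ^+ 2)^-1) * p z.

Lemma normal_pdf0E z : p z = normal_peak s * expR (- (2 * s ^+ 2)^-1 * z ^+ 2).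
Proof.
rewrite normal_pdfE//= /normal_fun subr0; congr (_ * expR _).
by rewrite -mulr_natl mulNr mulNr mulrC.
Qed.

Lemma is_derive_normal_pdf (z : R) : is_derive z 1 p (p1 z).
Proof.
have -> : p = normal_peak s *: (expR \o ((- (2 * s ^+ 2)^-1) *: (id ^+ 2))) :> (R -> R).
  by apply/funext => x; rewrite normal_pdf0E.
apply: is_derive_eq.
rewrite /GRing.scale/= expr1 !mulr1 /p1 normal_pdf0E.
by rewrite !fctE /GRing.scale/=; field.
Qed.

Lemma is_derive_normal_pdf1 (z : R) : is_derive z 1 p1 (p2 z).
Proof.
have dp := is_derive_normal_pdf z.
have -> : p1 = ((- (s ^+ 2)^-1) *: id) * p :> (R -> R).
  by apply/funext => x; rewrite /p1 !fctE /GRing.scale/=; field.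
apply: is_derive_eq.
rewrite /p1 /p2 !fctE /GRing.scale/= ?mulr1.
by field.
Qed.

Lemma is_derive_normal_cdf (y : R) : is_derive y 1 F (p y).
Proof.
have int_p : (@lebesgue_measure R).-integrable
    [set` Interval -oo%O (BRight (y + 1))] (EFin \o p).
  by apply: (integrableS measurableT) => //; exact: integrable_normal_pdf.
have [||dF F'] := @continuous_FTC1 R p -oo%O y (y + 1) _ int_p (ltNyr _).
- by rewrite ltrDl.
- exact: continuous_normal_pdf.
apply: DeriveDef; first exact: dF.
by rewrite -derive1E -F'.
Qed.

(** With w = z^2 / (2 s^2), the polynomial factor is at most 1 + z^4 = 1 + 4 s^4 w^2, which the
    exponential exp w >= (1 + w/2)^2 absorbs. This single bound controls all derivatives of the cdf
    met below. *)
Lemma normal_pdf_moment_bound : exists2 K, 0 <= K &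
  forall z k, (k <= 4)%N -> `|z| ^+ k * p z <= K.
Proof.
exists (normal_peak s * (1 + 16 * s ^+ 4)).
  by rewrite mulr_ge0 ?normal_peak_ge0// addr_ge0// mulr_ge0// exprn_ge0// ltW.
move=> z k k4.
rewrite normal_pdf0E mulrCA ler_wpM2l ?normal_peak_ge0//.
set w := (2 * s ^+ 2)^-1 * z ^+ 2.
have w0 : 0 <= w by rewrite mulr_ge0 ?sqr_ge0// invr_ge0 mulr_ge0// sqr_ge0.
have e0 : 0 < expR w by exact: expR_gt0.
rewrite mulNr -/w expRN ler_pdivrMr//.
have zk : `|z| ^+ k <= 1 + z ^+ 4.
  have z4 : z ^+ 4 = `|z| ^+ 4 by rewrite -normrX ger0_norm// exprn_even_ge0.
  rewrite z4; have [z1|z1] := leP `|z| 1.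
    rewrite (le_trans (_ : _ <= 1)) ?exprn_ile1// lerDl exprn_ge0//.
  rewrite (le_trans (_ : _ <= `|z| ^+ 4)) ?lerDr// ler_eXn2l//.
apply: le_trans zk _.
(* Squaring the linear bound for exp (w/2) produces the quadratic growth needed against w^2. *)
have ew : (1 + w / 2) ^+ 2 <= expR w.
  have -> : expR w = expR (w / 2) ^+ 2 by rewrite -expRM_natl; congr expR; field.
  by rewrite lerXn2r ?nnegrE ?expR_ge0// ?addr_ge0// ?divr_ge0// expR_ge1Dx.
have zw : z ^+ 4 = 4 * s ^+ 4 * w ^+ 2 by rewrite /w; field.
have s40 : 0 <= s ^+ 4 by rewrite exprn_ge0// ltW.
apply: le_trans (_ : _ <= (1 + 16 * s ^+ 4) * (1 + w / 2) ^+ 2) _; last first.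
  by rewrite ler_wpM2l// addr_ge0// mulr_ge0.
rewrite zw.
have w2 : 0 <= w ^+ 2 by exact: sqr_ge0.
nra.
Qed.

Lemma normal_cdf_ge0 y : 0 <= F y.
Proof. exact: fine_ge0. Qed.

Let fin_cdf y : normal_prob 0 s [set` `]-oo, y]] \is a fin_num.
Proof. exact: (@fin_num_measure _ _ _ (normal_prob 0 s)). Qed.

Lemma normal_cdf_le1 y : F y <= 1.
Proof.
rewrite -lee_fin fineK//.
exact: (@probability_le1 _ _ _ (normal_prob 0 s)).
Qed.

Lemma normal_cdf_nondecreasing : {homo F : x y / x <= y}.
Proof.
move=> x y xy; rewrite /F fine_le//.
apply: (@le_measure _ _ _ (normal_prob 0 s)); rewrite ?inE//.
exact: subitvPr.
Qed.

(** The identity, seen as a random variable under the normal law, has [normal_cdf] as its cdf up to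
    [fine], so general limits of cdfs at infinity apply. *)
Let idRV : {RV (normal_prob 0 s) >-> R} :=
  HB.pack (@idfun R) (isMeasurableFun.Build _ _ (measurableTypeR R) R
    idfun (@measurable_id _ (measurableTypeR R) setT)).

Lemma normal_cdf_tails (e : R) : 0 < e ->
  exists2 K, 0 < K & F (- K) <= e /\ 1 - e <= F K.
Proof.
move=> e0.
have cdfE : cdf idRV = (fun r => normal_prob 0 s [set` `]-oo, r]]).
  by apply/funext => r; rewrite /cdf /distribution /pushforward preimage_id.
have Fy : F x @[x --> +oo%R] --> (1 : R).
  apply/fine_cvg; have := @cvg_cdfy1 _ _ _ _ idRV.
  by rewrite cdfE.
have FNy : F x @[x --> -oo%R] --> (0 : R).
  apply/fine_cvg; have := @cvg_cdfNy0 _ _ _ _ idRV.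
  by rewrite cdfE.
have /cvgrPdist_le/(_ e e0)[M [_ HM]] := Fy.
have /cvgrPdist_le/(_ e e0)[N [_ HN]] := FNy.
pose K := Num.max 1 (Num.max (M + 1) (- N + 1)).
have K1 : 1 <= K by rewrite le_max lexx.
have KM : M < K by rewrite lt_max; apply/orP; right; rewrite lt_max ltrDl ltr01.
have KN : - K < N.
  by rewrite ltrNl lt_max; apply/orP; right; rewrite lt_max ltrDl ltr01 orbT.
exists K; first by rewrite (lt_le_trans _ K1).
have /= := HM _ KM; have /= := HN _ KN.
rewrite sub0r normrN (ger0_norm (normal_cdf_ge0 _)) => -> H; split => //.
by rewrite lerBlDl -lerBlDr (le_trans (ler_norm _)).
Qed.

End normal_cdf.

(** * Uniform expansions of the normal cdf in space and in scale *)

Section heat_flow.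
Context (R : realType).
Variable s : R.
Hypothesis s_gt0 : 0 < s.
Let s_neq0 : s != 0. Proof. by rewrite gt_eqF. Qed.

Local Notation p := (normal_pdf 0 s).
Local Notation F := (normal_cdf s).

Lemma bmfun_normal_cdf d (T : measurableType d) (m : T -> R) :
  measurable_fun setT m -> bounded_mfun (fun w => F (m w)).
Proof.
move=> mm; apply: bmfun_comp mm _; split; last first.
  by exists 1 => y; rewrite ger0_norm ?normal_cdf_ge0// normal_cdf_le1.
apply: nondecreasing_measurable => //; exact: normal_cdf_nondecreasing.
Qed.

Lemma normal_cdf_lipschitz : exists2 L, 0 <= L &
  forall x y, `|F y - F x| <= L * `|y - x|.
Proof.
have [K K0 pK] := normal_pdf_moment_bound s_gt0.
exists K => //; apply: (lipschitz_derive_bound (is_derive_normal_cdf s_gt0)).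
move=> x; have := pK x 0%N isT.
by rewrite expr0 mul1r ger0_norm// normal_pdf_ge0.
Qed.

(** The quadratic term carries a plus sign because F'' (z) = - (z / s^2) p (z); the third derivative
    is bounded by the moment bound with exponents 2 and 0. *)
Lemma normal_cdf_taylor : exists2 K, 0 <= K & forall z h,
  `|F (z + h) - F z - h * p z + h ^+ 2 / 2 * (z / s ^+ 2 * p z)| <= K * `|h| ^+ 3.
Proof.
have [K K0 pK] := normal_pdf_moment_bound s_gt0.
have s40 : 0 <= (s ^+ 4)^-1 by rewrite invr_ge0 exprn_ge0// ltW.
have s20 : 0 <= (s ^+ 2)^-1 by rewrite invr_ge0 exprn_ge0// ltW.
exists (K * (s ^+ 4)^-1 + K * (s ^+ 2)^-1) => [|z h].
  by rewrite addr_ge0 ?mulr_ge0.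
have := taylor2_bound (is_derive_normal_cdf s_gt0) (is_derive_normal_pdf s_gt0)
  (is_derive_normal_pdf1 s_gt0).
move=> /(_ (K * (s ^+ 4)^-1 + K * (s ^+ 2)^-1)) H.
rewrite -[X in `|X|](_ : F (z + h) - F z - h * p z -
  h ^+ 2 / 2 * (- (z / s ^+ 2) * p z) = _); last by ring.
apply: H => x; rewrite mulrBl (le_trans (ler_normB _ _))// lerD//.
  rewrite normrM (ger0_norm (normal_pdf_ge0 _ _ _)) normrM normrX.
  by rewrite (ger0_norm s40) mulrAC ler_wpM2r// pK.
rewrite normrM (ger0_norm (normal_pdf_ge0 _ _ _)) (ger0_norm s20) mulrC.
by rewrite ler_wpM2r//; have := pK x 0%N isT; rewrite expr0 mul1r.
Qed.

(** First-order expansion in the scale at rho = 1, where the derivative of F (z rho) is z p (z).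
    Uniformity in z is the point: the error contains z^3 times the density at an intermediate point,
    a bounded product. *)
Lemma normal_cdf_scale : exists2 K, 0 <= K & forall z rho, 2^-1 <= rho <= 1 ->
  `|F (z * rho) - F z - (rho - 1) * (z * p z)| <= K * (rho - 1) ^+ 2.
Proof.
have [K K0 pK] := normal_pdf_moment_bound s_gt0.
have s20 : 0 <= (s ^+ 2)^-1 by rewrite invr_ge0 exprn_ge0// ltW.
exists (4 * K * (s ^+ 2)^-1) => [|z rho /andP[rho_ge rho_le]].
  by rewrite !mulr_ge0.
have [t /andP[t0 t1]] := mean_value (is_derive_normal_cdf s_gt0) z (z * rho).
set z' := z + _ => ->.
have [t' /andP[t'0 t'1]] := mean_value (is_derive_normal_pdf s_gt0) z z'.
(* The intermediate point is z k. Since k >= 1/2, the factor z^2 is at most 4 (z k)^2, so that the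
   cubic moment bound applies at z k itself. *)
set k := 1 + t' * t * (rho - 1).
have -> : z + t' * (z' - z) = z * k by rewrite /z' /k; ring.
have kge : 2^-1 <= k.
  have tt0 : 0 <= t' * t by rewrite mulr_ge0.
  have tt1 : t' * t <= 1 by rewrite mulr_ile1.
  by rewrite /k; nra.
move=> pE.
have -> : p z' * (z * rho - z) - (rho - 1) * (z * p z) =
    (rho - 1) * z * (p z' - p z) by ring.
rewrite pE.
have -> : (rho - 1) * z * (- (z * k / s ^+ 2) * p (z * k) * (z' - z)) =
  - (t * (s ^+ 2)^-1 * (z ^+ 2 * (z * k) * p (z * k))) * (rho - 1) ^+ 2.
  by rewrite /z'; field.
rewrite normrM normrN (ger0_norm (sqr_ge0 (rho - 1))) ler_wpM2r ?sqr_ge0//.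
have H := pK (z * k) 3%N isT.
have zk : `|z ^+ 2| <= 4 * `|z * k| ^+ 2.
  rewrite normrX normrM exprMn mulrCA ler_peMr ?sqr_ge0//.
  by rewrite ger0_norm ?(le_trans _ kge)//; nra.
have pz : `|p (z * k)| = p (z * k) by rewrite ger0_norm ?normal_pdf_ge0.
have -> : `|t * (s ^+ 2)^-1 * (z ^+ 2 * (z * k) * p (z * k))| =
    (s ^+ 2)^-1 * (t * (`|z ^+ 2| * `|z * k| * p (z * k))).
  rewrite normrM (normrM t) (ger0_norm t0) (ger0_norm s20).
  by rewrite normrM (normrM (z ^+ 2)) pz; ring.
rewrite [leRHS]mulrC ler_wpM2l//.
apply: le_trans (_ : `|z ^+ 2| * `|z * k| * p (z * k) <= _).
  by rewrite ler_piMl// !mulr_ge0// normal_pdf_ge0.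
apply: le_trans (_ : 4 * `|z * k| ^+ 2 * `|z * k| * p (z * k) <= _).
  by rewrite !ler_wpM2r// normal_pdf_ge0.
by rewrite -mulrA -mulrA ler_wpM2l// mulrA -exprSr.
Qed.

(** Here rho = (1 + eta)^(-1/2), and the expansion 1 - eta/2 + O(eta^2) follows from the algebraic
    equation alone after multiplying by 2 (1 + rho). It serves both the time step 1/n and the final
    passage from sqrt (1 + e^2) to 1. *)
Lemma inv_sqrt_expansion (rho eta : R) : 0 < rho -> 0 <= eta ->
  rho ^+ 2 * (1 + eta) = 1 ->
  [/\ rho <= 1, 1 - rho <= eta & `|rho - 1 + eta / 2| <= eta ^+ 2].
Proof.
move=> rho0 eta0 E.
have rho1 : rho <= 1.
  rewrite leNgt; apply/negP => rho1.
  by nra.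
have rho_eta : 1 - rho <= eta by nra.
have E2 : (1 - rho) * (1 + rho) = eta * rho ^+ 2.
  by transitivity (rho ^+ 2 * (1 + eta) - rho ^+ 2); [rewrite E|]; ring.
split => //.
have E3 : (rho - 1 + eta / 2) * (2 * (1 + rho)) = eta * ((2 * rho + 1) * (1 - rho)).
  have -> : (rho - 1 + eta / 2) * (2 * (1 + rho)) =
    - 2 * ((1 - rho) * (1 + rho)) + eta * (1 + rho) by field.
  by rewrite E2; ring.
have pos : 0 < 2 * (1 + rho) by rewrite mulr_gt0// addr_gt0.
rewrite -(ler_pM2r pos) -[X in _ * X <= _](gtr0_norm pos) -normrM E3 ger0_norm.
  rewrite expr2 -mulrA ler_wpM2l//; nra.
by rewrite !mulr_ge0//; lra.
Qed.

End heat_flow.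

(** * Central limit theorem for bounded variables *)

Lemma telescope_bound (R : realType) (u : nat -> R) (n : nat) (D : R) :
  (forall k, (k < n)%N -> `|u k.+1 - u k| <= D) -> `|u n - u 0%N| <= n%:R * D.
Proof.
elim: n => [_|n IH H]; first by rewrite subrr normr0 mul0r.
have -> : u n.+1 - u 0%N = (u n - u 0%N) + (u n.+1 - u n) by ring.
rewrite -natr1 mulrDl mul1r (le_trans (ler_normD _ _))// lerD ?H//.
by apply: IH => k kn; apply: H; exact: ltnW.
Qed.

Section clt.
Context (R : realType).
Variable s : R.
Hypothesis s_gt0 : 0 < s.
Let s_neq0 : s != 0. Proof. by rewrite gt_eqF. Qed.
Local Notation p := (normal_pdf 0 s).
Local Notation F := (normal_cdf s).

Variables (mu : probability R R) (phi : R -> R).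
Hypothesis bphi : bounded_mfun phi.
Hypothesis phi_mean : \int[mu]_x phi x = 0.
Hypothesis phi_var : \int[mu]_x (phi x ^+ 2) = s ^+ 2.

(* u(t, b) = F (b / sqrt t) solves the heat equation u_t = s^2/2 u_bb: the
   first and second order terms of the spatial and temporal expansions cancel. *)
Lemma heat_step (e : R) : 0 < e -> exists2 C, 0 <= C &
  forall n t b, (0 < n)%N -> n%:R^-1 <= e ^+ 2 -> e ^+ 2 <= t ->
  `|\int[mu]_x F ((b - (Num.sqrt n%:R)^-1 * phi x) / Num.sqrt t) -
    F (b / Num.sqrt (t + n%:R^-1))| <= C * (n%:R * Num.sqrt n%:R)^-1.
Proof.
move=> e0.
have [K K0 taylor] := normal_cdf_taylor s_gt0.
have [K' K'0 scale] := normal_cdf_scale s_gt0.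
have [K'' K''0 pK] := normal_pdf_moment_bound s_gt0.
have [mphi [M phiM]] := bphi.
have M0 : 0 <= M by rewrite (le_trans _ (phiM 0)).
(* [C1] bounds the cubic Taylor error, the spatial increment being at most M / (e sqrt n); [C2]
   bounds the error in time, quadratic in eta <= 1 / (e^2 n). *)
pose C1 := K * (M * e^-1) ^+ 3.
pose C2 := (K' + K'') * (e ^-1) ^+ 4.
have C10 : 0 <= C1 by rewrite mulr_ge0// exprn_ge0// mulr_ge0// invr_ge0 ltW.
have C20 : 0 <= C2 by rewrite mulr_ge0 ?addr_ge0// exprn_ge0// invr_ge0 ltW.
exists (C1 + C2); first exact: addr_ge0.
move=> n t b n0 ne te.
have nR0 : 0 < n%:R :> R by rewrite ltr0n.
set q := Num.sqrt n%:R.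
have q0 : 0 < q by rewrite sqrtr_gt0.
have qq : q ^+ 2 = n%:R by rewrite sqr_sqrtr// ltW.
have q1 : 1 <= q by rewrite -sqrtr1 ler_wsqrtr// ler1n.
have t0 : 0 < t by rewrite (lt_le_trans _ te)// exprn_gt0.
set w := Num.sqrt t.
have w0 : 0 < w by rewrite sqrtr_gt0.
have ww : w ^+ 2 = t by rewrite sqr_sqrtr// ltW.
have we : w^-1 <= e^-1.
  by rewrite lef_pV2 ?posrE// -[leLHS](gtr0_norm e0) -sqrtr_sqr ler_wsqrtr.
have e'0 : 0 <= e^-1 by rewrite invr_ge0 ltW.
have n'0 : 0 <= n%:R^-1 :> R by rewrite invr_ge0 ltW.
have w'0 : 0 <= w^-1 by rewrite invr_ge0 ltW.
have q'0 : 0 <= q^-1 by rewrite invr_ge0 ltW.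
set z := b / w.
pose h x := - (w^-1 * q^-1) * phi x.
have bh : bounded_mfun h by apply: bmfunM => //; exact: bmfun_cst.
have hM x : `|h x| <= M * e^-1 * q^-1.
  have -> : M * e^-1 * q^-1 = (e^-1 * q^-1) * M by ring.
  rewrite /h normrM normrN [`|_ / q|]ger0_norm ?mulr_ge0// ler_pM ?mulr_ge0//.
  by rewrite ler_wpM2r.
(* eta = 1 / (n t) plays two roles: it is the relative time increment, and s^2 eta is the second
   moment of the spatial increment [h]. *)
pose eta := w^-1 ^+ 2 * n%:R^-1.
have eta0 : 0 <= eta by rewrite mulr_ge0 ?exprn_ge0// invr_ge0 ltW.
have eta_le : eta <= e^-1 ^+ 2 * n%:R^-1.
  by rewrite ler_wpM2r// lerXn2r ?nnegrE.
(* This is where 1/n <= e^2 is used; it forces rho >= 1/2, the range in which the scale expansion is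
   uniform. *)
have eta1 : eta <= 1.
  rewrite (le_trans eta_le)// exprVn mulrC ler_pdivrMr ?mul1r//.
  by rewrite exprn_gt0.
have space : `|\int[mu]_x F ((b - q^-1 * phi x) / w) - F z +
    eta / 2 * (z * p z)| <= C1 * (n%:R * q)^-1.
  have -> : \int[mu]_x F ((b - q^-1 * phi x) / w) - F z + eta / 2 * (z * p z) =
      \int[mu]_x (F (z + h x) - F z - h x * p z + h x ^+ 2 / 2 * (z / s ^+ 2 * p z)).
    have bF : bounded_mfun (fun x => F (z + h x)).
      by apply: bmfun_normal_cdf; apply: measurable_funD => //; exact: bh.1.
    have bhp : bounded_mfun (fun x => h x * p z).
      by apply: bmfunM => //; exact: bmfun_cst.
    have bhh : bounded_mfun (fun x => h x ^+ 2 / 2 * (z / s ^+ 2 * p z)).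
      apply: bmfunM; last exact: bmfun_cst.
      by apply: bmfunM; [exact: bmfunX|exact: bmfun_cst].
    have bc : bounded_mfun (fun _ : R => F z) by exact: bmfun_cst.
    rewrite expD//; last by apply: bmfunB => //; exact: bmfunB.
    rewrite expB//; last exact: bmfunB.
    rewrite expB// exp_cst.
    have -> : \int[mu]_x (h x * p z) = 0.
      transitivity (\int[mu]_x ((- (w^-1 * q^-1) * p z) * phi x)).
        by apply: eq_Rintegral => x _; rewrite /h; ring.
      by rewrite expZ// phi_mean mulr0.
    have -> : \int[mu]_x F ((b - q^-1 * phi x) / w) = \int[mu]_x F (z + h x).
      by apply: eq_Rintegral => x _; congr F; rewrite /z /h; ring.
    have -> : \int[mu]_x (h x ^+ 2 / 2 * (z / s ^+ 2 * p z)) = eta / 2 * (z * p z).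
      transitivity (\int[mu]_x (eta / 2 * (z / s ^+ 2 * p z) * phi x ^+ 2)).
        apply: eq_Rintegral => x _; rewrite /h /eta -qq.
        by field; rewrite !gt_eqF.
      rewrite expZ ?phi_var; last exact: bmfunX.
      by field.
    by rewrite subr0.
  apply: exp_normr_le => [|x].
    apply: bmfunD.
      apply: bmfunB; last by apply: bmfunM => //; exact: bmfun_cst.
      apply: bmfunB; last exact: bmfun_cst.
      by apply: bmfun_normal_cdf; apply: measurable_funD => //; exact: bh.1.
    apply: bmfunM; last exact: bmfun_cst.
    by apply: bmfunM; [exact: bmfunX|exact: bmfun_cst].
  apply: le_trans (taylor z (h x)) _.
  rewrite /C1 -mulrA ler_wpM2l//.
  apply: le_trans (_ : (M * e^-1 * q^-1) ^+ 3 <= _).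
    by rewrite lerXn2r// ?nnegrE// (le_trans _ (hM x)).
  by rewrite exprMn -qq -exprSr -exprVn.
have tn0 : 0 < t + n%:R^-1 by rewrite addr_gt0// invr_gt0.
pose rho := w / Num.sqrt (t + n%:R^-1).
have rho0 : 0 < rho by rewrite divr_gt0// sqrtr_gt0.
have rhoE : rho ^+ 2 * (1 + eta) = 1.
  rewrite /rho expr_div_n ww sqr_sqrtr; last exact: ltW.
  rewrite /eta exprVn ww.
  have -> : 1 + t^-1 / n%:R = (t + n%:R^-1) / t.
    by rewrite mulrDl divff ?gt_eqF// [n%:R^-1 * _]mulrC.
  by rewrite mulrA divfK ?gt_eqF// divff ?gt_eqF.
have [rho1 rho_eta rho_eta2] := inv_sqrt_expansion rho0 eta0 rhoE.
have rho2 : 2^-1 <= rho <= 1.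
  rewrite rho1 andbT leNgt; apply/negP => rho12.
  by nra.
have time : `|F (b / Num.sqrt (t + n%:R^-1)) - F z + eta / 2 * (z * p z)| <=
    C2 * (n%:R * q)^-1.
  have -> : b / Num.sqrt (t + n%:R^-1) = z * rho.
    by rewrite /z /rho; field; rewrite !gt_eqF// sqrtr_gt0.
  have -> : F (z * rho) - F z + eta / 2 * (z * p z) =
     (F (z * rho) - F z - (rho - 1) * (z * p z)) +
     (rho - 1 + eta / 2) * (z * p z) by ring.
  apply: le_trans (ler_normD _ _) _.
  apply: le_trans (_ : (K' + K'') * eta ^+ 2 <= _).
    rewrite [leRHS]mulrDl lerD//.
      apply: le_trans (scale _ _ rho2) _.
      by rewrite ler_wpM2l// -sqrrN opprB lerXn2r// nnegrE// subr_ge0.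
    rewrite normrM mulrC ler_pM//.
    rewrite normrM [`|p z|]ger0_norm ?normal_pdf_ge0//.
    by have := pK z 1%N isT; rewrite expr1.
  rewrite /C2 -mulrA ler_wpM2l ?addr_ge0//.
  apply: le_trans (_ : (e^-1 ^+ 2 * n%:R^-1) ^+ 2 <= _).
    by rewrite lerXn2r ?nnegrE// (le_trans _ eta_le).
  rewrite exprMn -exprM ler_wpM2l ?exprn_ge0//.
  (* The error in time is of order 1/n^2; q >= 1 weakens it to the rate 1 / (n q) of the spatial
     error. *)
  rewrite exprVn lef_pV2 ?posrE ?mulr_gt0 ?exprn_gt0// expr2.
  by rewrite ler_wpM2l ?(ltW nR0)// -qq expr2 ler_peMl// ltW.
rewrite (mulrDl C1).
set A := \int[mu]_x _ in space *; set B := F (b / _) in time *.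
have -> : A - B = (A - F z + eta / 2 * (z * p z)) -
  (B - F z + eta / 2 * (z * p z)) by ring.
by apply: le_trans (ler_normB _ _) _; exact: lerD.
Qed.

Context d (T : measurableType d) (P : probability T R).
Variable X : nat -> {RV P >-> R}.
Hypothesis indepX : mutually_independent X.
Hypothesis lawX : forall i A, measurable A -> P (X i @^-1` A) = mu A.

Definition normalized_sum n (w : T) : R :=
  (Num.sqrt n%:R)^-1 * \sum_(i < n) phi (X i w).

(** Lindeberg replacement without Gaussian variables: F (b / sqrt t) already is the average of a
    half-line indicator over Gaussian noise of variance s^2 t, so exchanging a summand for noise
    only moves t. *)
Lemma smoothed_clt (e a : R) : 0 < e -> exists2 C, 0 <= C &
  forall n, (0 < n)%N -> n%:R^-1 <= e ^+ 2 ->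
  `|\int[P]_w F ((a - normalized_sum n w) / e) - F (a / Num.sqrt (e ^+ 2 + 1))| <=
  C * (Num.sqrt n%:R)^-1.
Proof.
move=> e0; have [C C0 step] := heat_step e0; exists C => // n n0 ne.
have nR0 : 0 < n%:R :> R by rewrite ltr0n.
set q := Num.sqrt n%:R; have q0 : 0 < q by rewrite sqrtr_gt0.
(* The remaining time falls from e^2 + 1 at k = 0, where no summand is present, to the floor e^2 at
   k = n; each summand costs 1/n. *)
pose t k : R := e ^+ 2 + (n - k)%:R / n%:R.
pose S k w := \sum_(i < k) phi (X i w).
pose u k := \int[P]_w F ((a - q^-1 * S k w) / Num.sqrt (t k)).
have mphiX i : measurable_fun setT (fun w => phi (X i w)).
  by apply: measurableT_comp => //; exact: bphi.1.
have incr k : (k < n)%N -> `|u k.+1 - u k| <= C * (n%:R * q)^-1.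
  move=> kn.
  (* The newest summand sits in the first coordinate and the earlier partial sum in the second,
     ready for integrating out [X k]. *)
  pose g (xy : R * R) := F ((a - q^-1 * xy.2 - q^-1 * phi xy.1) / Num.sqrt (t k.+1)).
  have bg : bounded_mfun g.
    apply: bmfun_normal_cdf; apply: measurable_funM => //.
    apply: measurable_funB.
      by apply: measurable_funB => //; apply: measurable_funM.
    apply: measurable_funM => //; apply: measurableT_comp => //.
    exact: bphi.1.
  have offS : measurable_off X k (S k).
    apply: measurable_sum => i.
    apply: measurableT_comp; first exact: bphi.1.
    by apply: measurable_off_RV; rewrite ltn_eqF.
  have mS := measurable_off_measurable offS.
  have -> : u k.+1 = \int[P]_w \int[mu]_x g (x, S k w).
    rewrite -(exp_indep indepX (lawX k) offS bg).
    apply: eq_Rintegral => w _; rewrite /g /S big_ord_recr.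
    by rewrite [in LHS]mulrDr opprD addrA.
  have bF : bounded_mfun (fun w => F ((a - q^-1 * S k w) / Num.sqrt (t k))).
    apply: bmfun_normal_cdf; apply: measurable_funM => //.
    by apply: measurable_funB => //; exact: measurable_funM.
  have bG : bounded_mfun (fun w => \int[mu]_x g (x, S k w)).
    exact: (bmfun_comp mS (bmfun_exp mu bg)).
  rewrite /u -expB//; apply: exp_normr_le => [|w]; first exact: bmfunB.
  have -> : t k = t k.+1 + n%:R^-1.
    rewrite /t -addrA; congr (_ + _).
    by rewrite -(subnSK kn) -natr1 mulrDl mul1r.
  have te : e ^+ 2 <= t k.+1 by rewrite lerDl divr_ge0.
  exact: (step n (t k.+1) (a - q^-1 * S k w) n0 ne te).
have := telescope_bound incr.
have -> : n%:R * (C * (n%:R * q)^-1) = C * q^-1.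
  by field; rewrite !gt_eqF.
have -> : u n = \int[P]_w F ((a - normalized_sum n w) / e).
  apply: eq_Rintegral => w _; rewrite /t subnn mul0r addr0 sqrtr_sqr gtr0_norm//.
have -> // : u 0%N = F (a / Num.sqrt (e ^+ 2 + 1)).
rewrite /u /S /t subn0 divff ?gt_eqF//.
under eq_Rintegral do rewrite big_ord0 mulr0 subr0.
by rewrite exp_cst.
Qed.

End clt.

(** * From smoothed expectations to convergence in distribution *)

Section weak_convergence.
Context (R : realType) d (T : measurableType d) (P : probability T R).

Lemma exp_bool (b : T -> bool) : measurable_fun setT b ->
  \int[P]_w (b w)%:R = fine (P [set w | b w]).
Proof.
move=> mb; have mB : measurable [set w | b w].
  by rewrite -[X in measurable X]setTI; exact: (mb measurableT [set true]).
rewrite /Rintegral; congr fine.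
transitivity (\int[P]_w (\1_[set w | b w] w)%:E)%E.
  apply: eq_integral => w _; rewrite indicE; congr ((_%:R)%:E).
  by case: (boolP (b w)) => bw; [rewrite mem_set|rewrite memNset//; apply/negP].
by rewrite integral_indic// setIT.
Qed.

Lemma near_inv_sqrt (e : R) : 0 < e ->
  \forall n \near \oo, (Num.sqrt n%:R)^-1 <= e.
Proof.
move=> e0; near=> n.
have en : e^-1 ^+ 2 <= n%:R by near: n; exact: nbhs_infty_ger.
have e'0 : 0 < e^-1 by rewrite invr_gt0.
have : e^-1 <= Num.sqrt n%:R.
  by rewrite -[leLHS](gtr0_norm e'0) -sqrtr_sqr ler_wsqrtr.
move=> H; rewrite -[leRHS]invrK lef_pV2// posrE//.
exact: lt_le_trans H.
Unshelve. all: by end_near. Qed.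

Lemma near_inv_nat (e : R) : 0 < e -> \forall n \near \oo, n%:R^-1 <= e.
Proof.
move=> e0; near=> n.
have en : e^-1 <= n%:R by near: n; exact: nbhs_infty_ger.
rewrite -[leRHS]invrK lef_pV2// posrE ?invr_gt0//.
by apply: lt_le_trans en; rewrite invr_gt0.
Unshelve. all: by end_near. Qed.

Variable s : R.
Hypothesis s_gt0 : 0 < s.
Local Notation F := (normal_cdf s).

(** Up to an error th, the indicator of Y <= x lies between F ((x - eta - Y) / e) and F ((x + eta -
    Y) / e): within distance eta of x monotonicity and 0 <= F <= 1 suffice, beyond it the tails of F
    do. *)
Lemma conv_in_distribution_smoothed (Y : nat -> T -> R) :
  (forall n, measurable_fun setT (Y n)) ->
  (forall e a : R, 0 < e -> forall th : R, 0 < th -> \forall n \near \oo,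
     `|\int[P]_w F ((a - Y n w) / e) - F (a / Num.sqrt (e ^+ 2 + 1))| <= th) ->
  conv_in_distribution P Y (normal_prob 0 s).
Proof.
move=> mY smooth x _.
(* The final arithmetic, with four errors of size t on each side: the sandwich, the smoothed limit
   in n, the factor sqrt (1 + e^2), and the shift by eta. Hence th = dl / 4 below. *)
have combine (f1 f2 f3 u v i j1 j2 t : R) : i <= j1 + t -> j2 - t <= i ->
    f2 - f1 <= t -> f1 - f3 <= t -> - (v - f3) <= t -> u - f2 <= t ->
    `|j2 - v| <= t -> `|j1 - u| <= t -> `|f1 - i| <= 4 * t.
  rewrite !ler_norml => ? ? ? ? ? ? /andP[? ?] /andP[? ?].
  by apply/andP; split; lra.
have fin_cdf : normal_prob 0 s [set` `]-oo, x]] \is a fin_num.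
  exact: (@fin_num_measure _ _ _ (normal_prob 0 s)).
have mb n : measurable_fun setT (fun w => Y n w <= x).
  by apply: measurable_fun_ler.
have mA n : measurable [set w | Y n w <= x].
  by rewrite -[X in measurable X]setTI; exact: (mb n measurableT [set true]).
rewrite -(fineK fin_cdf) -/(F x).
have -> : (fun n => P [set w | Y n w <= x]) =
    EFin \o (fun n => \int[P]_w (Y n w <= x)%R%:R).
  by apply/funext => n /=; rewrite exp_bool// fineK// fin_num_measure.
apply: cvg_EFin; first exact: nearW.
apply/cvgrPdist_le => dl dl0.
have [L L0 lipF] := normal_cdf_lipschitz s_gt0.
pose th := dl / 4; have th0 : 0 < th by rewrite divr_gt0.
pose eta := th / (L + 1).
have eta0 : 0 < eta by rewrite divr_gt0// ltr_wpDl.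
have Leta : L * eta <= th.
  rewrite /eta mulrCA ler_piMr ?(ltW th0)// ler_pdivrMr ?mul1r ?lerDl//.
  by rewrite ltr_wpDl.
have [K K0 [FNK FK]] := normal_cdf_tails s th0.
pose B := L * (`|x| + eta).
have B0 : 0 <= B by rewrite mulr_ge0// addr_ge0// ltW.
(* The second bound makes eta / e reach the tail threshold K; the third, together with e <= 1, gives
   e^2 B <= th, the cost of replacing sqrt (1 + e^2) by 1. *)
pose e := Num.min 1 (Num.min (eta / K) (th / (B + 1))).
have e0 : 0 < e.
  by rewrite !lt_min ltr01 !divr_gt0// ltr_wpDl.
have e1 : e <= 1 by rewrite ge_min lexx.
have eK : K <= eta / e.
  rewrite ler_pdivlMr// mulrC -ler_pdivlMr//.
  by rewrite ge_min ge_min lexx !orbT.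
have eB : e ^+ 2 * B <= th.
  have : e <= th / (B + 1) by rewrite !ge_min lexx !orbT.
  rewrite ler_pdivlMr ?ltr_wpDl// => H.
  by nra.
have sqrt_e (a : R) : `|a| <= `|x| + eta -> `|F (a / Num.sqrt (e ^+ 2 + 1)) - F a| <= th.
  move=> ax; apply: le_trans (lipF _ _) _.
  set q := Num.sqrt _.
  have q0 : 0 < q by rewrite sqrtr_gt0 addr_gt0// exprn_gt0.
  have [r1 r2 _] : [/\ q^-1 <= 1, 1 - q^-1 <= e ^+ 2 &
      `|q^-1 - 1 + e ^+ 2 / 2| <= (e ^+ 2) ^+ 2].
    apply: inv_sqrt_expansion; rewrite ?invr_gt0 ?sqr_ge0// exprVn.
    rewrite sqr_sqrtr ?addr_ge0 ?sqr_ge0// [1 + _]addrC mulVf// gt_eqF//.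
    by rewrite addr_gt0// exprn_gt0.
  have -> : a / q - a = a * - (1 - q^-1) by ring.
  rewrite normrM normrN [`|1 - _|]ger0_norm ?subr_ge0//.
  apply: le_trans eB; rewrite /B [leRHS]mulrCA ler_wpM2l// [leRHS]mulrC.
  by rewrite ler_pM ?subr_ge0.
have xeta : x + eta - x = eta by ring.
have etax : x - (x - eta) = eta by ring.
have upx : `|x + eta| <= `|x| + eta.
  by rewrite (le_trans (ler_normD _ _))// (gtr0_norm eta0).
have dnx : `|x - eta| <= `|x| + eta.
  by rewrite (le_trans (ler_normB _ _))// (gtr0_norm eta0).
have up1 : F (x + eta) - F x <= th.
  apply: le_trans (ler_norm _) _; apply: le_trans (lipF _ _) _.
  by rewrite xeta (gtr0_norm eta0).
have dn1 : F x - F (x - eta) <= th.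
  apply: le_trans (ler_norm _) _; apply: le_trans (lipF _ _) _.
  by rewrite etax (gtr0_norm eta0).
have := le_trans (ler_norm _) (sqrt_e _ upx).
have : - (F ((x - eta) / Num.sqrt (e ^+ 2 + 1)) - F (x - eta)) <= th.
  by apply: le_trans (ler_norm _) _; rewrite normrN; exact: sqrt_e.
set U := F ((x + eta) / _); set V := F ((x - eta) / _).
move=> dn2 up2.
near=> n.
have : `|\int[P]_w F ((x + eta - Y n w) / e) - U| <= th.
  by near: n; exact: smooth.
have : `|\int[P]_w F ((x - eta - Y n w) / e) - V| <= th.
  by near: n; exact: smooth.
have bF a : bounded_mfun (fun w => F ((a - Y n w) / e)).
  by apply: bmfun_normal_cdf; apply: measurable_funM => //; exact: measurable_funB.
have bb : bounded_mfun (fun w => (Y n w <= x)%R%:R : R) by exact: bmfun_bool.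
have H1 : \int[P]_w (Y n w <= x)%R%:R <= \int[P]_w F ((x + eta - Y n w) / e) + th.
  rewrite -[th in leRHS](exp_cst P) -expD//; last exact: bmfun_cst.
  apply: exp_le => //; first by apply: bmfunD => //; exact: bmfun_cst.
  move=> w; have [Yx|Yx] := leP (Y n w) x; last first.
    by rewrite addr_ge0 ?normal_cdf_ge0// ltW.
  rewrite -lerBlDr (le_trans FK)//; apply: normal_cdf_nondecreasing.
  by rewrite (le_trans eK)// ler_pM2r ?invr_gt0//; lra.
have H2 : \int[P]_w F ((x - eta - Y n w) / e) - th <= \int[P]_w (Y n w <= x)%R%:R.
  rewrite -[th in leLHS](exp_cst P) -expB//; last exact: bmfun_cst.
  apply: exp_le => //; first by apply: bmfunB => //; exact: bmfun_cst.
  move=> w; have [Yx|Yx] := leP (Y n w) x.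
    rewrite lerBlDr (le_trans (normal_cdf_le1 _ _))// lerDl ltW//.
  rewrite lerBlDr add0r (le_trans _ FNK)//; apply: normal_cdf_nondecreasing.
  rewrite (le_trans (_ : _ <= - (eta / e)))// ?lerN2//.
  by rewrite -[- (eta / e)]mulNr ler_pM2r ?invr_gt0//; lra.
move=> H3 H4.
have dlE : dl = 4 * th by rewrite /th; field.
rewrite [leRHS]dlE.
exact: (combine _ _ _ _ _ _ _ _ _ H1 H2 up1 dn1 dn2 up2 H3 H4).
Unshelve. all: by end_near. Qed.

End weak_convergence.

(** * Transfer of the central limit theorem to statistics close in L1 *)

Section linearization.
Context (R : realType) d (T : measurableType d) (P : probability T R).
Variables (s : R) (mu : probability R R) (phi : R -> R) (X : nat -> {RV P >-> R}).
Hypothesis s_gt0 : 0 < s.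
Hypothesis bphi : bounded_mfun phi.
Hypothesis phi_mean : \int[mu]_x phi x = 0.
Hypothesis phi_var : \int[mu]_x (phi x ^+ 2) = s ^+ 2.
Hypothesis indepX : mutually_independent X.
Hypothesis lawX : forall i A, measurable A -> P (X i @^-1` A) = mu A.

Lemma bmfun_RV (f : R -> R) i : bounded_mfun f -> bounded_mfun (fun w => f (X i w)).
Proof. by apply: bmfun_comp. Qed.

Lemma bmfun_normalized_sum n : bounded_mfun (normalized_sum phi X n).
Proof.
apply: bmfunM; first exact: bmfun_cst.
by apply: bmfun_sum => i; exact: bmfun_RV.
Qed.

(** Slutsky in L1 form: for fixed e the test function F ((a - y) / e) is Lipschitz in y with
    constant L / e, so the smoothed expectations of [Y n] and of the normalized sum differ by
    O(n^(-1/2)). *)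
Lemma conv_in_distribution_linearized (Y : nat -> T -> R) (D : R) :
  (forall n, bounded_mfun (Y n)) ->
  (forall n, (1 < n)%N ->
    \int[P]_w `|Y n w - normalized_sum phi X n w| <= D * (Num.sqrt n%:R)^-1) ->
  conv_in_distribution P Y (normal_prob 0 s).
Proof.
move=> bY YD; apply: conv_in_distribution_smoothed => // [n|e a e0 th th0].
  exact: (bY n).1.
have [C C0 clt] := smoothed_clt s_gt0 bphi phi_mean phi_var indepX lawX a e0.
have [L L0 lipF] := normal_cdf_lipschitz s_gt0.
set F := normal_cdf s in clt lipF *.
(* The sign of D is read off the hypothesis at n = 2, where the left-hand side is the mean of an
   absolute value. *)
have D0 : 0 <= D.
  have s2 : 0 < (Num.sqrt 2%:R : R)^-1 by rewrite invr_gt0 sqrtr_gt0.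
  rewrite -(pmulr_lge0 _ s2) (le_trans _ (YD 2%N isT))//.
  by apply: Rintegral_ge0 => w _.
pose A := C + L * e^-1 * D + 1.
have A0 : 0 < A by rewrite ltr_wpDl// addr_ge0// !mulr_ge0// invr_ge0 ltW.
near=> n.
have n1 : (1 < n)%N by near: n; exact: nbhs_infty_gt.
have ne : n%:R^-1 <= e ^+ 2 by near: n; apply: near_inv_nat; exact: exprn_gt0.
have nA : (Num.sqrt n%:R)^-1 <= th / A.
  by near: n; apply: near_inv_sqrt; exact: divr_gt0.
have bF (Z : T -> R) : bounded_mfun Z -> bounded_mfun (fun w => F ((a - Z w) / e)).
  move=> bZ; apply: bmfun_normal_cdf; apply: measurable_funM => //.
  by apply: measurable_funB => //; exact: bZ.1.
have bW := bmfun_normalized_sum n.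
have H1 : `|\int[P]_w F ((a - Y n w) / e) -
    \int[P]_w F ((a - normalized_sum phi X n w) / e)| <=
    L * e^-1 * D * (Num.sqrt n%:R)^-1.
  rewrite -expB; [|exact: bF|exact: bF].
  apply: le_trans (exp_normr _ _) _; first by apply: bmfunB; exact: bF.
  apply: le_trans (_ : \int[P]_w (L * e^-1 * `|Y n w - normalized_sum phi X n w|) <= _).
    apply: exp_le.
    - by apply: bmfun_norm; apply: bmfunB; exact: bF.
    - by apply: bmfunM; [exact: bmfun_cst|apply: bmfun_norm; exact: bmfunB].
    move=> w; apply: le_trans (lipF _ _) _.
    rewrite -mulrBl normrM [`|e^-1|]ger0_norm ?invr_ge0 ?(ltW e0)//.
    rewrite -mulrA ler_wpM2l// mulrC ler_wpM2l ?invr_ge0 ?(ltW e0)//.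
    by rewrite opprB addrC addrA subrK distrC.
  rewrite expZ; last by apply: bmfun_norm; exact: bmfunB.
  by rewrite -[leRHS]mulrA ler_wpM2l ?mulr_ge0 ?invr_ge0 ?(ltW e0)//; exact: YD.
have := clt n (ltnW n1) ne.
move: H1.
set J := \int[P]_w _; set J' := \int[P]_w _; set f := F _.
move=> H1 H2; apply: le_trans (ler_distD J' _ _) _.
apply: le_trans (lerD H1 H2) _; rewrite -mulrDl.
apply: le_trans (_ : A * (Num.sqrt n%:R)^-1 <= _).
  by rewrite ler_wpM2r ?invr_ge0 ?sqrtr_ge0// /A addrC lerDl.
by rewrite mulrC -ler_pdivlMr.
Unshelve. all: by end_near. Qed.

End linearization.

(** * Orthogonality and second moments *)

Lemma sum_delta (R : nzRingType) n (j : 'I_n) : \sum_(i < n) (i == j)%:R = 1 :> R.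
Proof. by rewrite (bigD1 j)//= eqxx big1 ?addr0// => i /negbTE ->. Qed.

Section orthogonality.
Context (R : realType) d (T : measurableType d) (P : probability T R).
Variables (mu : probability R R) (X : nat -> {RV P >-> R}).
Hypothesis indepX : mutually_independent X.
Hypothesis lawX : forall i A, measurable A -> P (X i @^-1` A) = mu A.
Implicit Types k h : R * R -> R.

Lemma bmfun_RV2 k i j : bounded_mfun k -> bounded_mfun (fun w => k (X i w, X j w)).
Proof. by move=> bk; apply: bmfun_comp bk; exact: measurable_fun_pair. Qed.

Lemma bmfun_swap k : bounded_mfun k -> bounded_mfun (fun xy => k (xy.2, xy.1)).
Proof.
by move=> bk; apply: bmfun_comp bk; apply: measurable_fun_pair => //.
Qed.

(** The index v occurs only in the first slot of k, so integrating out [X v] with the other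
    variables frozen gives zero. The indices j, i and l may coincide. *)
Lemma exp_orthogonal1 k h v j i l : bounded_mfun k -> bounded_mfun h ->
  (forall z, \int[mu]_x k (x, z) = 0) -> v \notin [:: j; i; l] ->
  \int[P]_w (k (X v w, X j w) * h (X i w, X l w)) = 0.
Proof.
move=> bk bh k0; rewrite !inE !negb_or => /and3P[vj vi vl].
pose Y w : R * (R * R) := (X j w, (X i w, X l w)).
pose g (xy : R * (R * (R * R))) := k (xy.1, xy.2.1) * h xy.2.2.
have offY : measurable_off X v Y.
  apply: measurable_fun_pair; first by apply: measurable_off_RV; rewrite eq_sym.
  by apply: measurable_fun_pair; apply: measurable_off_RV; rewrite eq_sym.
have bg : bounded_mfun g.
  apply: bmfunM.
    apply: (@bmfun_comp _ _ _ _ _ (fun xy : R * (R * (R * R)) => (xy.1, xy.2.1))) bk.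
    apply: measurable_fun_pair => //.
    exact: measurableT_comp.
  apply: (@bmfun_comp _ _ _ _ _ (fun xy : R * (R * (R * R)) => xy.2.2)) bh.
  exact: measurableT_comp.
transitivity (\int[P]_w g (X v w, Y w)); first by [].
rewrite (exp_indep indepX (lawX v) offY bg).
transitivity (\int[P]_w (0 : R)); last by rewrite exp_cst.
apply: eq_Rintegral => w _; rewrite /g/=.
transitivity (\int[mu]_x (h (X i w, X l w) * k (x, X j w))).
  by apply: eq_Rintegral => x _; rewrite mulrC.
by rewrite expZ ?k0 ?mulr0//; exact: bmfun_section.
Qed.

Lemma exp_orthogonal2 k h v j i l : bounded_mfun k -> bounded_mfun h ->
  (forall z, \int[mu]_x k (z, x) = 0) -> v \notin [:: j; i; l] ->
  \int[P]_w (k (X j w, X v w) * h (X i w, X l w)) = 0.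
Proof.
move=> bk bh k0 vjil.
exact: (exp_orthogonal1 (bmfun_swap bk) bh k0 vjil).
Qed.

(** In the expanded square, i is an isolated index unless i = j or i = l. At most 2 n pairs survive,
    each contributing at most 1. *)
Lemma exp_sum_sqr (k : R * R -> R) (l n : nat) : bounded_mfun k ->
  (forall xy, `|k xy| <= 1) -> (forall z, \int[mu]_x k (x, z) = 0) ->
  (l < n)%N ->
  \int[P]_w ((\sum_(i < n) k (X i w, X l w)) ^+ 2) <= 2 * n%:R.
Proof.
move=> bk k1 k0 ln.
have bkk i j : bounded_mfun (fun w => k (X i w, X l w) * k (X j w, X l w)).
  by apply: bmfunM; exact: bmfun_RV2.
have -> : \int[P]_w ((\sum_(i < n) k (X i w, X l w)) ^+ 2) =
  \sum_(i < n) \sum_(j < n) \int[P]_w (k (X i w, X l w) * k (X j w, X l w)).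
  transitivity (\int[P]_w (\sum_(i < n) \sum_(j < n)
      (k (X i w, X l w) * k (X j w, X l w)))).
    by apply: eq_Rintegral => w _; rewrite expr2 big_distrlr.
  rewrite exp_sum; last by move=> i; apply: bmfun_sum => j.
  by apply: eq_bigr => i _; rewrite exp_sum.
apply: le_trans (_ : \sum_(i < n) \sum_(j < n)
    ((i == j)%:R + (i == Ordinal ln)%:R) <= _); last first.
  rewrite exchange_big/=.
  under eq_bigr do rewrite big_split/= !sum_delta.
  by rewrite sumr_const card_ord -[leLHS]mulr_natr.
apply: ler_sum => i _; apply: ler_sum => j _.
have [ij|ij] := eqVneq i j.
  apply: le_trans (_ : 1 <= _); last by rewrite lerDl.
  apply: exp_le_cst => // w.
  by apply: le_trans (ler_norm _) _; rewrite normrM mulr_ile1.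
have [il|il] := eqVneq i (Ordinal ln).
  rewrite add0r; apply: exp_le_cst => // w.
  by apply: le_trans (ler_norm _) _; rewrite normrM mulr_ile1.
rewrite exp_orthogonal1 ?addr0//.
by rewrite !inE !negb_or; apply/and3P; split; [exact: il|exact: ij|exact: il].
Qed.

(** Of the n^4 products in the expanded square, those with an index occurring only once vanish. This
    leaves O(n^2) of them, each at most 2 x 2 = 4. *)
Lemma exp_dsum_sqr (k : R * R -> R) (n : nat) : bounded_mfun k ->
  (forall xy, `|k xy| <= 2) -> (forall z, \int[mu]_x k (x, z) = 0) ->
  (forall z, \int[mu]_x k (z, x) = 0) ->
  \int[P]_w ((\sum_(i < n) \sum_(l < n) k (X i w, X l w)) ^+ 2) <= 20 * n%:R ^+ 2.
Proof.
move=> bk k2 k01 k02.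
pose f (q : 'I_n * 'I_n) w := k (X q.1 w, X q.2 w).
have bff q q' : bounded_mfun (fun w => f q w * f q' w).
  by apply: bmfunM; exact: bmfun_RV2.
have -> : \int[P]_w ((\sum_(i < n) \sum_(l < n) k (X i w, X l w)) ^+ 2) =
  \sum_q \sum_q' \int[P]_w (f q w * f q' w).
  transitivity (\int[P]_w (\sum_q \sum_q' (f q w * f q' w))).
    by apply: eq_Rintegral => w _; rewrite expr2 pair_bigA big_distrlr.
  rewrite exp_sum; last by move=> i; apply: bmfun_sum => j.
  by apply: eq_bigr => i _; rewrite exp_sum.
(* [cnt] dominates the indicator of the surviving quadruples: both pairs diagonal, or each member of
   q repeated in q'. Its total is n^2 + 4 n^2, and the factor 4 gives the constant 20. *)
pose cnt (q q' : 'I_n * 'I_n) : R := (q.1 == q.2)%:R * (q'.1 == q'.2)%:R +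
  ((q.1 == q'.1)%:R + (q.1 == q'.2)%:R) * ((q.2 == q'.1)%:R + (q.2 == q'.2)%:R).
have sum_cnt : \sum_q \sum_q' 4 * cnt q q' = 20 * n%:R ^+ 2.
  have diag : \sum_(q : 'I_n * 'I_n) (q.1 == q.2)%:R = n%:R :> R.
    rewrite -(pair_bigA _ (fun i j : 'I_n => (i == j)%:R))/= exchange_big/=.
    by under eq_bigr do rewrite sum_delta; rewrite sumr_const card_ord.
  have cross (q' : 'I_n * 'I_n) :
      \sum_(q : 'I_n * 'I_n) (((q.1 == q'.1)%:R + (q.1 == q'.2)%:R) *
        ((q.2 == q'.1)%:R + (q.2 == q'.2)%:R)) = 4 :> R.
    rewrite -(pair_bigA _ (fun i j : 'I_n => ((i == q'.1)%:R + (i == q'.2)%:R) *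
        ((j == q'.1)%:R + (j == q'.2)%:R)))/=.
    rewrite -big_distrlr/= !big_split/= !sum_delta.
    by ring.
  under eq_bigr do rewrite -mulr_sumr.
  rewrite -mulr_sumr exchange_big/=.
  under eq_bigr do rewrite big_split/= cross -mulr_suml diag.
  rewrite big_split/= -mulr_sumr diag sumr_const card_prod !card_ord -[4 *+ _]mulr_natr natrM.
  by ring.
rewrite -sum_cnt; apply: ler_sum => q _; apply: ler_sum => q' _.
have cnt0 : 0 <= 4 * cnt q q'.
  by rewrite mulr_ge0// addr_ge0 ?mulr_ge0// addr_ge0.
have bnd : 1 <= cnt q q' -> \int[P]_w (f q w * f q' w) <= 4 * cnt q q'.
  move=> c1; apply: le_trans (_ : 4 <= _); last by rewrite ler_peMr.
  apply: exp_le_cst => // w; apply: le_trans (ler_norm _) _.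
  rewrite normrM (le_trans (ler_pM _ _ (k2 _) (k2 _)))//.
  by rewrite -natrM.
case: q q' cnt0 bnd => [i l] [i' l']; rewrite /cnt /f/= => cnt0 bnd.
have comm : \int[P]_w (k (X i w, X l w) * k (X i' w, X l' w)) =
    \int[P]_w (k (X i' w, X l' w) * k (X i w, X l w)).
  by apply: eq_Rintegral => w _; rewrite mulrC.
(* Three tests suffice: once i, l and i' each recur among the other indices, [cnt] is at least 1. *)
have [H1|/negPn] := boolP ((i : nat) \notin [:: l : nat; i' : nat; l' : nat]).
  by rewrite exp_orthogonal1.
have [H2|/negPn] := boolP ((l : nat) \notin [:: i : nat; i' : nat; l' : nat]).
  by rewrite exp_orthogonal2.
have [H3|/negPn] := boolP ((i' : nat) \notin [:: l' : nat; i : nat; l : nat]).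
  by rewrite comm exp_orthogonal1.
rewrite !inE => h3 h2 h1; apply: bnd; rewrite -!val_eqE/=.
move: (i : nat) (l : nat) (i' : nat) (l' : nat) h1 h2 h3 => {i l i' l' cnt0 comm}.
move=> i l i' l'; have [<-|il] := eqVneq i l.
  move=> _ _; have [_ _|_ /=] := eqVneq i' l'.
    by rewrite mulr1 lerDl mulr_ge0// addr_ge0.
  rewrite orbb => /eqP ->; rewrite eqxx.
  by case: (_ == _); rewrite /=; lra.
move=> /= h1 h2 _.
rewrite mul0r add0r -[1]mulr1; apply: ler_pM => //.
  by case: (i == i') h1; case: (i == l') => //= _; lra.
by case: (l == i') h2; case: (l == l') => //= _; lra.
Qed.

End orthogonality.

(** * Decomposition of the statistic *)

Section decomposition.
Context (R : realType).

Lemma bin2R n : ('C(n, 2))%:R = n%:R * (n%:R - 1) / 2 :> R.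
Proof.
case: n => [|n]; first by rewrite bin0n/= !mul0r.
have /(congr1 (fun m => m%:R : R)) : ('C(n.+1, 2) * 2 = n.+1 * n)%N.
  by rewrite -[X in (_ * X)%N]/(2`!)%N bin_ffact ffactnS ffactn1.
have -> : n.+1%:R - 1 = n%:R :> R by rewrite -natr1 addrK.
by rewrite !natrM => <-; rewrite mulfK// pnatr_eq0.
Qed.

Lemma sum_lt_sym n (f : 'I_n -> 'I_n -> R) : (forall i j, f i j = f j i) ->
  \sum_i \sum_j f i j =
  2 * (\sum_(i < n) \sum_(j < n | (i < j)%N) f i j) + \sum_i f i i.
Proof.
move=> fC.
have -> : \sum_i \sum_j f i j = \sum_(i < n) (\sum_(j < n | (i < j)%N) f i j +
    (\sum_(j < n | (j < i)%N) f i j + f i i)).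
  apply: eq_bigr => i _; rewrite (bigID (fun j : 'I_n => (i < j)%N))/=; congr (_ + _).
  rewrite (bigD1 i) ?ltnn//= addrC; congr (_ + _); apply: eq_bigl => j.
  by rewrite -leqNgt andbC -val_eqE/= -ltn_neqAle.
rewrite !big_split/= addrA; congr (_ + _).
have -> : \sum_(i < n) \sum_(j < n | (j < i)%N) f i j =
    \sum_(i < n) \sum_(j < n | (i < j)%N) f i j.
  rewrite (exchange_big_dep xpredT)//=.
  by apply: eq_bigr => i _; apply: eq_bigr => j _; exact: fC.
by rewrite mulr_natl mulr2n.
Qed.

Context (T : Type) (X : nat -> T -> R).

(** Exchanging the two indices shows that strict inequalities in either direction are equally many,
    and together with the ties they exhaust the n^2 pairs. *)
Lemma mean_FnE n w : (0 < n)%N ->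
  n%:R^-1 * \sum_(k < n) Fn X n w (X k w) =
  2^-1 - 2^-1 * n%:R^-2 * \sum_(k < n) \sum_(i < n) (X i w == X k w)%:R.
Proof.
move=> n0; have nR : n%:R != 0 :> R by rewrite pnatr_eq0 gtn_eqF.
pose A : R := \sum_(k < n) \sum_(i < n) (X i w < X k w)%R%:R.
pose E : R := \sum_(k < n) \sum_(i < n) (X i w == X k w)%:R.
have AE : A + A + E = n%:R ^+ 2.
  rewrite {2}/A exchange_big/= -!big_split/=.
  transitivity (\sum_(k < n) \sum_(i < n) (1 : R)).
    apply: eq_bigr => k _; rewrite -!big_split/=; apply: eq_bigr => i _.
    by case: ltrgtP => //= _; rewrite ?addr0 ?add0r.
  by rewrite !sumr_const card_ord -mulrnA -natrX -mulnn.
rewrite /Fn -mulr_sumr -/A -/E.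
have -> : E = n%:R ^+ 2 - 2 * A by rewrite -AE; ring.
by field.
Qed.

(** The pairs not counted by [Hn] are those with both members among the Q indices satisfying t <= 2
    X_i, a proportion Q (Q - 1) / (n (n - 1)). *)
Lemma HnE n w t : (1 < n)%N ->
  let Q := \sum_(i < n) (t <= 2 * X i w)%R%:R in
  Hn X n w t = 1 - (Q ^+ 2 - Q) / (n%:R * (n%:R - 1)).
Proof.
move=> n1 Q; pose q (i : 'I_n) : R := (t <= 2 * X i w)%R%:R.
have n0 : n%:R != 0 :> R by rewrite pnatr_eq0; case: n n1 {Q q}.
have n1' : n%:R - 1 != 0 :> R by rewrite subr_eq0 pnatr_eq1 gtn_eqF.
have minE i j : (2 * Num.min (X i w) (X j w) < t)%R%:R =
    1 - (t <= 2 * X i w)%R%:R * (t <= 2 * X j w)%R%:R :> R.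
  have -> : (2 * Num.min (X i w) (X j w) < t) =
      ~~ ((t <= 2 * X i w) && (t <= 2 * X j w)).
    by rewrite ltNge; congr (~~ _); rewrite minr_pMr// le_min.
  by case: (t <= _); case: (t <= _); rewrite /= ?mulr1 ?mul1r ?mul0r ?subrr ?subr0.
have H := @sum_lt_sym n (fun i j => 1 - q i * q j).
have -> : Hn X n w t = ('C(n, 2))%:R^-1 *
    \sum_(i < n) \sum_(j < n | (i < j)%N) (1 - q i * q j).
  by congr (_ * _); apply: eq_bigr => i _; apply: eq_bigr => j _; exact: minE.
move: H; set S := \sum_(i < n) \sum_(j < n | (i < j)%N) _ => H.
have {H} SE : n%:R ^+ 2 - Q ^+ 2 = 2 * S + (n%:R - Q).
  transitivity (\sum_(i < n) \sum_(j < n) (1 - q i * q j)).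
    under eq_bigr do rewrite sumrB/= -mulr_sumr sumr_const card_ord.
    rewrite sumrB/= sumr_const card_ord -mulr_suml -/Q.
    by rewrite !expr2 -[n%:R *+ n]mulr_natr.
  rewrite H; last by move=> i j; rewrite mulrC.
  congr (_ + _); rewrite sumrB sumr_const card_ord; congr (_ - _).
  by apply: eq_bigr => i _; rewrite /q; case: (t <= _); rewrite /= ?mulr1 ?mulr0.
have -> : S = (n%:R ^+ 2 - Q ^+ 2 - (n%:R - Q)) / 2 by rewrite SE; field.
rewrite bin2R; by field; rewrite n0 n1'.
Qed.

(** A pathwise identity for arbitrary [G] and [b], followed by the triangle inequality: write Q_k =
    n G (x_k) + N_k and expand Q_k^2. The four errors are ties, the correction Q (Q - 1) / (n (n -
    1)) against Q^2 / n^2, the bilinear term minus its projection b, and the squares of N_k. *)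
Lemma In_decomposition n w (G b : R -> R) : (1 < n)%N ->
  let x i := X i w in
  let eta i k := (x k <= 2 * x i)%R%:R - G (x k) in
  (`|In X n w - n%:R^-1 * \sum_(k < n) (G (x k) ^+ 2 + 2 * b (x k) - 2^-1)| <=
  2^-1 * n%:R^-2 * \sum_(k < n) \sum_(i < n) (x i == x k)%:R + 2 * n%:R^-1 +
  2 * n%:R^-2 * `|\sum_(i < n) \sum_(k < n) (G (x k) * eta i k - b (x i))| +
  n%:R^-3 * \sum_(k < n) (\sum_(i < n) eta i k) ^+ 2 : Prop).
Proof.
move=> n1 x eta.
have n0 : (0 < n)%N by exact: ltnW.
have nR0 : 0 < n%:R :> R by rewrite ltr0n.
have nR : n%:R != 0 :> R by rewrite gt_eqF.
have n2 : 2 <= n%:R :> R by rewrite ler_nat.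
pose Q (k : 'I_n) : R := \sum_(i < n) (x k <= 2 * x i)%R%:R.
pose N (k : 'I_n) : R := \sum_(i < n) eta i k.
pose rho k := (Q k ^+ 2 - Q k) / (n%:R * (n%:R - 1)) - Q k ^+ 2 / n%:R ^+ 2.
have QN k : Q k = n%:R * G (x k) + N k.
  by rewrite /N /eta sumrB sumr_const card_ord -[G _ *+ n]mulr_natl [RHS]addrC subrK.
have rho_le k : `|rho k| <= 2 * n%:R^-1.
  have Q0 : 0 <= Q k by exact: sumr_ge0.
  have Qn : Q k <= n%:R.
    apply: le_trans (_ : \sum_(i < n) (1 : R) <= _).
      by apply: ler_sum => i _; rewrite lern1 leq_b1.
    by rewrite sumr_const card_ord.
  move: Q0 Qn; rewrite /rho; move: (Q k) => y y0 yn.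
  (* The exact difference makes the order 1/n visible: its numerator is at most n^2, its denominator
     n^2 (n - 1), and n >= 2. *)
  have -> : (y ^+ 2 - y) / (n%:R * (n%:R - 1)) - y ^+ 2 / n%:R ^+ 2 =
      - (y * (n%:R - y) / (n%:R ^+ 2 * (n%:R - 1))).
    by field; rewrite nR/= subr_eq0 pnatr_eq1 gtn_eqF.
  have d0 : 0 < n%:R ^+ 2 * (n%:R - 1) :> R.
    by rewrite mulr_gt0 ?exprn_gt0//; lra.
  rewrite normrN ger0_norm; last first.
    by rewrite divr_ge0 ?(ltW d0)// mulr_ge0// subr_ge0.
  rewrite ler_pdivrMr//.
  have -> : 2 / n%:R * (n%:R ^+ 2 * (n%:R - 1)) = 2 * n%:R * (n%:R - 1) :> R by field.
  by nra.
pose tie : R := \sum_(k < n) \sum_(i < n) (x i == x k)%:R.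
pose Sc := \sum_(i < n) \sum_(k < n) (G (x k) * eta i k - b (x i)).
pose SN := \sum_(k < n) N k ^+ 2.
have InE : In X n w = 2^-1 - 2^-1 * n%:R^-2 * tie - 1 +
    n%:R^-1 * \sum_(k < n) (rho k + Q k ^+ 2 / n%:R ^+ 2).
  rewrite /In sumrB mulrBr mean_FnE// -/tie -[RHS]addrA; congr (_ + _).
  have -> : \sum_(k < n) Hn X n w (X k w) =
      \sum_(k < n) (1 - (rho k + Q k ^+ 2 / n%:R ^+ 2)).
    by apply: eq_bigr => k _; rewrite HnE// /rho subrK.
  by rewrite sumrB sumr_const card_ord mulrBr opprB mulVf// addrC.
have QE : n%:R^-1 * \sum_(k < n) (Q k ^+ 2 / n%:R ^+ 2) =
    n%:R^-1 * \sum_(k < n) (G (x k) ^+ 2 + 2 * b (x k)) +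
    2 * n%:R^-2 * Sc + n%:R^-3 * SN.
  have -> : Sc = \sum_(k < n) (G (x k) * N k) - n%:R * \sum_(k < n) b (x k).
    rewrite /Sc; under eq_bigr do rewrite sumrB sumr_const card_ord -[b _ *+ n]mulr_natl.
    rewrite sumrB -mulr_sumr exchange_big/=; congr (_ - _).
    by apply: eq_bigr => k _; rewrite mulr_sumr.
  have -> : \sum_(k < n) (Q k ^+ 2 / n%:R ^+ 2) = \sum_(k < n) G (x k) ^+ 2 +
      2 * n%:R^-1 * \sum_(k < n) (G (x k) * N k) + n%:R^-2 * SN.
    rewrite mulr_sumr mulr_sumr -!big_split/=; apply: eq_bigr => k _.
    by rewrite QN; field.
  rewrite big_split/= -mulr_sumr.
  by field.
have -> : In X n w - n%:R^-1 * \sum_(k < n) (G (x k) ^+ 2 + 2 * b (x k) - 2^-1) =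
    - (2^-1 * n%:R^-2 * tie) + n%:R^-1 * \sum_(k < n) rho k +
    2 * n%:R^-2 * Sc + n%:R^-3 * SN.
  have -> : \sum_(k < n) (G (x k) ^+ 2 + 2 * b (x k) - 2^-1) =
      \sum_(k < n) (G (x k) ^+ 2 + 2 * b (x k)) - n%:R * 2^-1.
    by rewrite sumrB sumr_const card_ord -[2^-1 *+ n]mulr_natl.
  rewrite InE [\sum_(k < n) (rho k + _)]big_split/= mulrDr QE.
  clear InE QE; move: tie Sc SN (\sum_(k < n) rho k) (\sum_(k < n) (G (x k) ^+ 2 + _)).
  by move=> *; field.
have pos m : 0 <= n%:R^- m :> R by rewrite invr_ge0 exprn_ge0// ltW.
apply: le_trans (ler_normD _ _) _; apply: lerD; last first.
  by rewrite ger0_norm// mulr_ge0// sumr_ge0// => k _; exact: sqr_ge0.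
apply: le_trans (ler_normD _ _) _; apply: lerD; last first.
  by rewrite normrM ger0_norm// mulr_ge0.
apply: le_trans (ler_normD _ _) _; apply: lerD.
  rewrite normrN ger0_norm// mulr_ge0 ?mulr_ge0//.
  by apply: sumr_ge0 => k _; exact: sumr_ge0.
rewrite normrM ger0_norm ?invr_ge0 ?(ltW nR0)// ler_pdivrMl//.
apply: le_trans (ler_norm_sum _ _ _) _.
apply: le_trans (_ : \sum_(k < n) 2 / n%:R <= _); first exact: ler_sum.
by rewrite sumr_const card_ord -[leLHS]mulr_natl.
Qed.

End decomposition.

(** * Projection of the kernel and linearization of the statistic *)

Section projection.
Context (R : realType) (mu : probability R R).

(** In a pair, the first coordinate is a member of the minimum and the second the comparison value.
    [dom_prob], [dom_dev] and [dom_proj] are the G, eta and b of [In_decomposition]. *)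
Definition dom_ker (xy : R * R) : R := (xy.2 <= 2 * xy.1)%R%:R.
Definition dom_prob (z : R) : R := \int[mu]_x dom_ker (x, z).
Definition dom_dev (xy : R * R) : R := dom_ker xy - dom_prob xy.2.
Definition dom_proj (x : R) : R := \int[mu]_z (dom_prob z * dom_dev (x, z)).
(* The degenerate part of the kernel: both its one-variable projections vanish. *)
Definition dom_deg (xy : R * R) : R :=
  dom_prob xy.2 * dom_dev xy - dom_proj xy.1.
Definition influence (x : R) : R := dom_prob x ^+ 2 + 2 * dom_proj x - 2^-1.

Lemma bmfun_dom_ker : bounded_mfun dom_ker.
Proof.
apply: bmfun_bool; apply: measurable_fun_ler => //.
exact: measurable_funM.
Qed.

Lemma dom_ker01 xy : 0 <= dom_ker xy <= 1.
Proof. by rewrite /dom_ker; case: (_ <= 2 * _); rewrite ?ler01 ?lexx. Qed.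

Lemma bmfun_dom_prob : bounded_mfun dom_prob.
Proof. exact: bmfun_exp bmfun_dom_ker. Qed.

Lemma dom_prob01 z : 0 <= dom_prob z <= 1.
Proof.
have bk := bmfun_section (z : R) bmfun_dom_ker.
apply/andP; split; first by apply: Rintegral_ge0 => x _; have /andP[] := dom_ker01 (x, z).
by apply: exp_le_cst => // x; have /andP[] := dom_ker01 (x, z).
Qed.

Lemma bmfun_dom_prob2 : bounded_mfun (fun xy : R * R => dom_prob xy.2).
Proof. by apply: bmfun_comp bmfun_dom_prob. Qed.

Lemma bmfun_dom_dev : bounded_mfun dom_dev.
Proof. by apply: bmfunB; [exact: bmfun_dom_ker|exact: bmfun_dom_prob2]. Qed.

Lemma dom_dev_le1 xy : `|dom_dev xy| <= 1.
Proof.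
rewrite /dom_dev; have := dom_ker01 xy; have := dom_prob01 xy.2.
move: (dom_ker xy) (dom_prob xy.2) => u v /andP[? ?] /andP[? ?].
by rewrite ler_norml; apply/andP; split; lra.
Qed.

Let wdev (xy : R * R) : R := dom_prob xy.2 * dom_dev xy.

Let bmfun_wdev : bounded_mfun wdev.
Proof. by apply: bmfunM; [exact: bmfun_dom_prob2|exact: bmfun_dom_dev]. Qed.

Let wdev_le1 xy : `|wdev xy| <= 1.
Proof.
rewrite normrM mulr_ile1// ?dom_dev_le1//.
by have /andP[? ?] := dom_prob01 xy.2; rewrite ger0_norm.
Qed.

Let wdev_swap : bounded_mfun (fun zx : R * R => wdev (zx.2, zx.1)).
Proof. exact: bmfun_swap. Qed.

Lemma bmfun_dom_proj : bounded_mfun dom_proj.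
Proof. exact: (bmfun_exp mu wdev_swap). Qed.

Lemma dom_proj_le1 x : `|dom_proj x| <= 1.
Proof.
apply: exp_normr_le => [|z]; last exact: (wdev_le1 (x, z)).
exact: (bmfun_section x wdev_swap).
Qed.

Lemma bmfun_dom_deg : bounded_mfun dom_deg.
Proof.
apply: bmfunB; first exact: bmfun_wdev.
by apply: bmfun_comp bmfun_dom_proj.
Qed.

Lemma dom_deg_le2 xy : `|dom_deg xy| <= 2.
Proof.
apply: le_trans (ler_normB _ _) _.
have := lerD (wdev_le1 xy) (dom_proj_le1 xy.1).
by rewrite -natr1.
Qed.

Lemma bmfun_influence : bounded_mfun influence.
Proof.
apply: bmfunB; last exact: bmfun_cst.
apply: bmfunD; first exact: bmfunX bmfun_dom_prob.
by apply: bmfunM; [exact: bmfun_cst|exact: bmfun_dom_proj].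
Qed.

Lemma exp_dom_dev z : \int[mu]_x dom_dev (x, z) = 0.
Proof.
rewrite /dom_dev expB; last 2 first.
  exact: (bmfun_section z bmfun_dom_ker).
  exact: (bmfun_cst _ (dom_prob z)).
by rewrite /= exp_cst subrr.
Qed.

Lemma exp_dom_deg2 x : \int[mu]_z dom_deg (x, z) = 0.
Proof.
rewrite /dom_deg expB; last 2 first.
  exact: (bmfun_section x wdev_swap).
  exact: (bmfun_cst _ (dom_proj x)).
by rewrite /= exp_cst subrr.
Qed.

Hypothesis proj_mean : \int[mu]_x dom_proj x = 0.
Hypothesis atomless : forall z, \int[mu]_x (x == z)%:R = 0 :> R.

Lemma exp_dom_deg1 z : \int[mu]_x dom_deg (x, z) = 0.
Proof.
rewrite /dom_deg expB; last 2 first.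
  exact: (bmfun_section z bmfun_wdev).
  exact: bmfun_dom_proj.
rewrite /= proj_mean subr0 expZ ?exp_dom_dev ?mulr0//.
exact: (bmfun_section z bmfun_dom_dev).
Qed.

Context d (T : measurableType d) (P : probability T R).
Variable X : nat -> {RV P >-> R}.
Hypothesis indepX : mutually_independent X.
Hypothesis lawX : forall i A, measurable A -> P (X i @^-1` A) = mu A.
Local Notation XT := (fun i => (X i : T -> R)).

Let bmfun_tie i k : bounded_mfun (fun w => (X i w == X k w)%:R : R).
Proof.
by apply: bmfun_bool; apply: measurable_fun_eqr.
Qed.

Lemma exp_tie i k : i != k -> \int[P]_w (X i w == X k w)%:R = 0 :> R.
Proof.
move=> ik.
have bg : bounded_mfun (fun xy : R * R => (xy.1 == xy.2)%:R : R).
  by apply: bmfun_bool; apply: measurable_fun_eqr.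
have off : measurable_off X i (X k) by apply: measurable_off_RV; rewrite eq_sym.
have -> : \int[P]_w (X i w == X k w)%:R = \int[P]_w \int[mu]_x (x == X k w)%:R :> R.
  exact: (exp_indep indepX (lawX i) off bg).
by under eq_Rintegral do rewrite atomless; rewrite exp_cst.
Qed.

Lemma bmfun_In n : bounded_mfun (In XT n).
Proof.
apply: bmfunM; first exact: bmfun_cst.
apply: bmfun_sum => k; apply: bmfunB; (apply: bmfunM; first exact: bmfun_cst).
  by apply: bmfun_sum => i; apply: bmfun_bool; exact: measurable_fun_ltr.
apply: bmfun_sum => i; apply: bmfun_sum => j; apply: bmfun_bool.
apply: measurable_fun_ltr => //; apply: measurable_funM => //.
exact: measurable_minr.
Qed.

(** Each error of the pathwise decomposition has mean O(1/n): ties survive only on the diagonal, and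
    the two degenerate sums are controlled through their second moments. Multiplication by sqrt n
    leaves n^(-1/2). *)
Lemma In_linearization n : (1 < n)%N ->
  \int[P]_w `|Num.sqrt n%:R * In XT n w - normalized_sum influence X n w| <=
  26 * (Num.sqrt n%:R)^-1.
Proof.
move=> n1; have n0 : (0 < n)%N by exact: ltnW.
have nR0 : 0 < n%:R :> R by rewrite ltr0n.
have nRn0 : n%:R != 0 :> R by rewrite gt_eqF.
set q : R := Num.sqrt n%:R.
have q0 : 0 < q by rewrite sqrtr_gt0.
have qq : q ^+ 2 = n%:R by rewrite sqr_sqrtr// ltW.
pose tie w : R := \sum_(k < n) \sum_(i < n) (X i w == X k w)%:R.
pose Sc w : R := \sum_(i < n) \sum_(k < n) dom_deg (X i w, X k w).
pose SN w : R := \sum_(k < n) (\sum_(i < n) dom_dev (X i w, X k w)) ^+ 2.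
pose bnd w := 2^-1 * n%:R^-2 * tie w + 2 * n%:R^-1 +
  2 * n%:R^-2 * (2^-1 * (n%:R + n%:R^-1 * Sc w ^+ 2)) + n%:R^-3 * SN w.
have btie : bounded_mfun tie by do 2 (apply: bmfun_sum => ?).
have bSc : bounded_mfun Sc.
  by do 2 (apply: bmfun_sum => ?); apply: bmfun_RV2; exact: bmfun_dom_deg.
have bSN : bounded_mfun SN.
  apply: bmfun_sum => ?; apply: bmfunX; apply: bmfun_sum => ?.
  by apply: bmfun_RV2; exact: bmfun_dom_dev.
have bSc2 : bounded_mfun (fun w => Sc w ^+ 2) by exact: bmfunX.
have bcst (r : R) : bounded_mfun (fun _ : T => r) by exact: bmfun_cst.
have b1 : bounded_mfun (fun w => 2^-1 * n%:R^-2 * tie w) by exact: bmfunM.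
have b2 : bounded_mfun (fun w => 2^-1 * n%:R^-2 * tie w + 2 * n%:R^-1) by exact: bmfunD.
have b3 : bounded_mfun (fun w => n%:R^-1 * Sc w ^+ 2) by exact: bmfunM.
have b4 : bounded_mfun (fun w => n%:R + n%:R^-1 * Sc w ^+ 2) by exact: bmfunD.
have b5 : bounded_mfun (fun w => 2^-1 * (n%:R + n%:R^-1 * Sc w ^+ 2)) by exact: bmfunM.
have b6 : bounded_mfun (fun w => 2 * n%:R^-2 * (2^-1 * (n%:R + n%:R^-1 * Sc w ^+ 2))).
  exact: bmfunM.
have b7 : bounded_mfun (fun w => n%:R^-3 * SN w) by exact: bmfunM.
have b8 : bounded_mfun (fun w => 2^-1 * n%:R^-2 * tie w + 2 * n%:R^-1 +
   2 * n%:R^-2 * (2^-1 * (n%:R + n%:R^-1 * Sc w ^+ 2))) by exact: bmfunD.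
have bbnd : bounded_mfun bnd by exact: bmfunD.
have pos m : 0 <= n%:R^- m :> R by rewrite invr_ge0 exprn_ge0// ltW.
have pointwise w : `|q * In XT n w - normalized_sum influence X n w| <= q * bnd w.
  have -> : normalized_sum influence X n w =
      q * (n%:R^-1 * \sum_(k < n) influence (X k w)).
    by rewrite /normalized_sum -/q mulrA -qq; congr (_ * _); field; rewrite gt_eqF.
  rewrite -mulrBr normrM (gtr0_norm q0) ler_wpM2l ?(ltW q0)//.
  apply: le_trans (@In_decomposition R T XT n w dom_prob dom_proj n1) _.
  rewrite /bnd lerD// lerD// ler_wpM2l ?mulr_ge0//.
  rewrite -[\sum_(i < n) _]/(Sc w).
  move: (Sc w) => y.
  (* The absolute value is traded for a square by 2 n |y| <= n^2 + y^2, which replaces a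
     Cauchy-Schwarz inequality for the expectation. *)
  have -> : 2^-1 * (n%:R + n%:R^-1 * y ^+ 2) = (n%:R ^+ 2 + `|y| ^+ 2) / (2 * n%:R).
    by rewrite real_normK ?num_real//; field.
  rewrite ler_pdivlMr ?mulr_gt0//.
  by have := sqr_ge0 (n%:R - `|y|); nra.
have Etie : \int[P]_w tie w <= n%:R.
  rewrite exp_sum; last by move=> k; exact: bmfun_sum.
  apply: le_trans (_ : \sum_(k < n) (1 : R) <= _); last by rewrite sumr_const card_ord.
  apply: ler_sum => k _; rewrite exp_sum//.
  rewrite (bigD1 k)//= big1 ?addr0; last by move=> i ik; rewrite exp_tie.
  by apply: exp_le_cst => // w; rewrite lern1 leq_b1.
have ESc : \int[P]_w (Sc w ^+ 2) <= 20 * n%:R ^+ 2.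
  apply: (exp_dsum_sqr indepX lawX); first exact: bmfun_dom_deg.
  - exact: dom_deg_le2.
  - exact: exp_dom_deg1.
  - exact: exp_dom_deg2.
have ESN : \int[P]_w SN w <= 2 * n%:R ^+ 2.
  rewrite exp_sum; last first.
    move=> k; apply: bmfunX; apply: bmfun_sum => i.
    by apply: bmfun_RV2; exact: bmfun_dom_dev.
  apply: le_trans (_ : \sum_(k < n) (2 * n%:R : R) <= _); last first.
    by rewrite sumr_const card_ord -[leLHS]mulr_natr expr2 mulrA.
  apply: ler_sum => k _; apply: (exp_sum_sqr indepX lawX) => //.
  - exact: bmfun_dom_dev.
  - exact: dom_dev_le1.
  - exact: exp_dom_dev.
apply: le_trans (_ : \int[P]_w (q * bnd w) <= _).
  apply: exp_le => //; last exact: bmfunM.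
  apply: bmfun_norm; apply: bmfunB; first by apply: bmfunM => //; exact: bmfun_In.
  exact: bmfun_normalized_sum bmfun_influence n.
rewrite expZ//.
have -> : \int[P]_w bnd w = 2^-1 * n%:R^-2 * \int[P]_w tie w + 2 * n%:R^-1 +
    2 * n%:R^-2 * (2^-1 * (n%:R + n%:R^-1 * \int[P]_w (Sc w ^+ 2))) +
    n%:R^-3 * \int[P]_w SN w.
  by rewrite expD// expD// expD// expZ// exp_cst expZ// expZ// expD// exp_cst expZ// expZ.
move: Etie ESc ESN.
move: (\int[P]_w tie w) (\int[P]_w (Sc w ^+ 2)) (\int[P]_w SN w) => A B C hA hB hC.
apply: le_trans (_ : q * (2^-1 * n%:R^-2 * n%:R + 2 * n%:R^-1 +
    2 * n%:R^-2 * (2^-1 * (n%:R + n%:R^-1 * (20 * n%:R ^+ 2))) +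
    n%:R^-3 * (2 * n%:R ^+ 2)) <= _).
  have n'0 : 0 <= n%:R^-1 :> R by rewrite invr_ge0 ltW.
  rewrite ler_wpM2l ?(ltW q0)// lerD// ?lerD// ler_wpM2l// ?mulr_ge0//.
  by rewrite ler_wpM2l// lerD// ler_wpM2l.
rewrite -qq.
(* The sum is 1/2 for ties, 2 for the binomial correction, 21 for the bilinear term and 2 for the
   squares, below the stated 26. *)
have -> : q * (2^-1 * q ^+ 2 ^- 2 * q ^+ 2 + 2 * (q ^+ 2)^-1 +
    2 * q ^+ 2 ^- 2 * (2^-1 * (q ^+ 2 + (q ^+ 2)^-1 * (20 * q ^+ 2 ^+ 2))) +
    q ^+ 2 ^- 3 * (2 * q ^+ 2 ^+ 2)) = (25 + 2^-1) * q^-1.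
  by field; rewrite gt_eqF.
by rewrite ler_wpM2r ?invr_ge0 ?(ltW q0)//; lra.
Qed.

End projection.

(** * The exponential law *)

Section exponential.
Context (R : realType) (lam : R).
Hypothesis lam_gt0 : 0 < lam.
Variable mu : probability R R.
Hypothesis mu_exp : forall A, measurable A -> mu A = exponential_prob lam A.
Local Notation leb := (@lebesgue_measure R).
Local Notation pdf := (exponential_pdf lam).

(* lebesgue_measure lives on measurableTypeR R, which has the same measurable
   sets as R but another display: mu is transported along the identity. *)
Let idR : {mfun R >-> measurableTypeR R} :=
  HB.pack (@idfun R) (isMeasurableFun.Build _ _ R (measurableTypeR R)
    idfun (@measurable_id _ R setT)).
Let nu : probability (measurableTypeR R) R := distribution mu idR.

Let nuE A : measurable A -> nu A = (\int[leb]_(x in A) (pdf x)%:E)%E.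
Proof. by move=> mA; rewrite -[RHS]/(exponential_prob lam A) -mu_exp. Qed.

Let nu_dom : nu `<< leb.
Proof.
apply/null_content_dominatesP => A mA A0; rewrite nuE//.
apply: null_set_integral => //; apply: measurable_funTS.
by apply/measurable_EFinP; exact: measurable_exponential_pdf.
Qed.

(** The law is known only through its values on sets. These determine the Radon-Nikodym derivative
    almost everywhere, which identifies it with the density and permits the change of variables. *)
Lemma exp_density (h : R -> R) : bounded_mfun h ->
  \int[mu]_x h x = fine (\int[leb]_x (h x * pdf x)%:E)%E.
Proof.
move=> bh; rewrite /Rintegral; congr fine.
transitivity (\int[nu]_x (h x)%:E)%E.
  rewrite /nu /distribution integral_pushforward//.
  - by apply/measurable_EFinP; exact: bh.1.
  - exact: (bmfun_integrable mu bh).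
rewrite -(Radon_Nikodym_change_of_variables nu_dom)//=; last first.
  exact: (@bmfun_integrable _ _ _ nu h bh).
have mpdf : measurable_fun setT (EFin \o pdf).
  by apply/measurable_EFinP; exact: measurable_exponential_pdf.
have mh : measurable_fun [set: measurableTypeR R] (EFin \o h).
  by apply/measurable_EFinP; exact: bh.1.
under [RHS]eq_integral do rewrite EFinM.
apply: ae_eq_integral => //.
- by apply: emeasurable_funM => //; apply: (measurable_int leb).
- exact: emeasurable_funM.
- apply: ae_eqe_mul2l => /=.
  rewrite Radon_NikodymE//=.
  case: cid => /= g [g1 g2 g3].
  apply: integral_ae_eq => //=.
  by move=> E _ mE; rewrite -g3//= nuE.
Qed.

(** The density vanishes on the negative half-line, so closed formulas are needed for nonnegative
    arguments only. *)
Lemma exp_eq_ge0 (f g : R -> R) : bounded_mfun f -> bounded_mfun g ->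
  (forall x, 0 <= x -> f x = g x) -> \int[mu]_x f x = \int[mu]_x g x.
Proof.
move=> bf bg fg; rewrite !exp_density//; congr fine; apply: eq_integral => x _.
have [x0|x0] := leP 0 x; first by rewrite fg.
by rewrite lt0_exponential_pdf// !mulr0.
Qed.

(** The truncation at 0 keeps e^(-r lam x) bounded on the whole line without changing it on the
    support of the law. *)
Definition expm (r x : R) := expR (- (r * lam * Num.max 0 x)).

Lemma expmM r r' x : expm r x * expm r' x = expm (r + r') x.
Proof. by rewrite /expm -expRD; congr expR; ring. Qed.

Lemma expm_ge0E r x : 0 <= x -> expm r x = expR (- (r * lam * x)).
Proof. by move=> x0; rewrite /expm max_r. Qed.

Lemma bmfun_expm r : 0 <= r -> bounded_mfun (expm r).
Proof.
move=> r0; split.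
  apply: measurableT_comp => //; apply: measurableT_comp => //.
  by apply: measurable_funM => //; exact: measurable_maxr.
exists 1 => x; rewrite ger0_norm ?expR_ge0// -expR0 ler_expR oppr_le0.
by rewrite !mulr_ge0// ?(ltW lam_gt0)// le_max lexx.
Qed.

(** Exponential tilting: the product is a multiple of the exponential density of rate (1 + r) lam,
    which reduces all the integrals below to total masses or cdfs. *)
Let expm_pdf r x : 0 <= r ->
  expm r x * pdf x = (1 + r)^-1 * exponential_pdf ((1 + r) * lam) x.
Proof.
move=> r0; have r1 : 1 + r != 0 by rewrite gt_eqF// ltr_pwDl.
have [x0|x0] := leP 0 x; last by rewrite !lt0_exponential_pdf// !mulr0.
rewrite expm_ge0E// !exponential_pdfE// mulrCA -expRD !mulrA mulVf// mul1r.
by congr (_ * expR _); ring.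
Qed.

Lemma exp_expm r : 0 <= r -> \int[mu]_x expm r x = (1 + r)^-1.
Proof.
move=> r0; rewrite exp_density; last exact: bmfun_expm.
have r1 : 0 < 1 + r by rewrite ltr_pwDl.
have rl : 0 < (1 + r) * lam by rewrite mulr_gt0.
under eq_integral do rewrite expm_pdf// EFinM.
rewrite integralZl//; last exact: integrable_exponential_pdf.
by rewrite integral_exponential_pdf// mule1.
Qed.

Let bmfun_le (y : R) : bounded_mfun (fun z : R => (z <= y)%R%:R : R).
Proof. by apply: bmfun_bool; exact: measurable_fun_ler. Qed.

Lemma exp_expm_le r y : 0 <= r -> 0 <= y ->
  \int[mu]_z ((z <= y)%R%:R * expm r z) =
  (1 + r)^-1 * (1 - expR (- ((1 + r) * lam * y))).
Proof.
move=> r0 y0; rewrite exp_density; last first.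
  by apply: bmfunM; [exact: bmfun_le|exact: bmfun_expm].
have r1 : 0 < 1 + r by rewrite ltr_pwDl.
have rl : 0 < (1 + r) * lam by rewrite mulr_gt0.
set rho := (1 + r) * lam in rl *.
transitivity (fine ((1 + r)^-1%:E * exponential_prob rho `[0%R, y])%E).
  have mI : measurable (`[0, y]%classic : set (measurableTypeR R)) by [].
  have intp : leb.-integrable `[0, y] (EFin \o exponential_pdf rho).
    by apply: (integrableS measurableT) => //; exact: integrable_exponential_pdf.
  apply: (congr1 fine).
  apply: etrans (integralZl mI intp (1 + r)^-1).
  rewrite [RHS]integral_mkcond.
  apply: eq_integral => z _; rewrite -mulrA expm_pdf// patchE.
  case: ifPn; rewrite ?inE ?notin_setE/= in_itv/=.
    by move=> /andP[z0 ->]; rewrite mul1r -EFinM.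
  move=> /negP; have [z0/=|z0 _] := leP 0 z.
    by move=> /negbTE ->; rewrite mul0r.
  by rewrite lt0_exponential_pdf// !mulr0.
have [->|yn0] := eqVneq y 0.
  by rewrite set_itv1 /exponential_prob integral_set1 mule0/= mulr0 oppr0 expR0 subrr mulr0.
have y_gt0 : 0 < y by rewrite lt_neqAle eq_sym yn0.
by rewrite exponential_prob_itv0c//= mulNr.
Qed.

Lemma exponential_atomless z : \int[mu]_x (x == z)%:R = 0 :> R.
Proof.
rewrite exp_bool; last exact: measurable_fun_eqr.
have -> : [set w | w == z] = [set z] by apply/seteqP; split=> x /= /eqP.
by rewrite mu_exp// /exponential_prob integral_set1.
Qed.

Lemma dom_probE z : 0 <= z -> dom_prob mu z = expm 2^-1 z.
Proof.
move=> z0; have z20 : 0 <= z / 2 by rewrite divr_ge0.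
have bt : bounded_mfun (fun x : R => (x == z / 2)%:R : R).
  by apply: bmfun_bool; exact: measurable_fun_eqr.
have b0 : bounded_mfun (expm 0) by exact: bmfun_expm.
have b1 : bounded_mfun (fun x : R => (x <= z / 2)%R%:R * expm 0 x).
  by apply: bmfunM => //; exact: bmfun_le.
have bc : bounded_mfun (fun _ : R => 1 : R) by exact: bmfun_cst.
(* The complementary half-line is closed at z / 2, so a null indicator corrects the boundary point;
   [expm 0] is the constant 1 in the form required by [exp_expm_le]. *)
transitivity (\int[mu]_x (1 - (x <= z / 2)%R%:R * expm 0 x + (x == z / 2)%:R)).
  apply: eq_Rintegral => x _; rewrite /dom_ker/= /expm !mul0r oppr0 expR0 mulr1.
  have -> : (z <= 2 * x) = (z / 2 <= x) by rewrite ler_pdivrMr// mulrC.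
  by case: ltrgtP => _ /=; rewrite ?subrr ?subr0 ?addr0 ?add0r.
rewrite expD//; last exact: bmfunB.
rewrite expB// exp_cst exponential_atomless addr0 exp_expm_le// addr0 invr1 !mul1r.
by rewrite subKr expm_ge0E//; congr (expR (- _)); field.
Qed.

(** For z >= 0 the integrand is 1{z <= 2 x} e^(-lam z / 2) - e^(-lam z). The two means are (2/3) (1
    - e^(-3 lam x)) and 1/2, since (1 + 1/2) 2 = 3. *)
Lemma dom_projE x : 0 <= x -> dom_proj mu x = 6^-1 - 2 / 3 * expm 3 x.
Proof.
move=> x0.
have half : 2^-1 + 2^-1 = 1 :> R by field.
have h0 : 0 <= 2^-1 :> R by [].
have b1 : bounded_mfun (fun z : R => (z <= 2 * x)%R%:R * expm 2^-1 z).
  by apply: bmfunM; [exact: bmfun_le|exact: bmfun_expm].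
have b2 : bounded_mfun (expm 1) by exact: bmfun_expm.
transitivity (\int[mu]_z ((z <= 2 * x)%R%:R * expm 2^-1 z - expm 1 z)).
  apply: exp_eq_ge0; last 2 first.
  - exact: bmfunB.
  - move=> z z0; rewrite /dom_dev /dom_ker/= dom_probE// mulrBr expmM half.
    by rewrite mulrC.
  apply: bmfunM; first exact: bmfun_dom_prob.
  exact: (bmfun_section x (bmfun_swap (bmfun_dom_dev mu))).
rewrite expB// exp_expm_le ?mulr_ge0// exp_expm// expm_ge0E//.
have -> : (1 + 2^-1) * lam * (2 * x) = 3 * lam * x by field.
by field.
Qed.

Lemma dom_proj_mean : \int[mu]_x dom_proj mu x = 0.
Proof.
have b3 : bounded_mfun (expm 3) by exact: bmfun_expm.
have bc : bounded_mfun (fun _ : R => 6^-1 : R) by exact: bmfun_cst.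
have b3' : bounded_mfun (fun x => 2 / 3 * expm 3 x).
  by apply: bmfunM => //; exact: bmfun_cst.
rewrite (exp_eq_ge0 (bmfun_dom_proj mu) (bmfunB bc b3') dom_projE).
rewrite expB// exp_cst expZ// exp_expm//.
by field.
Qed.

Lemma influenceE x : 0 <= x ->
  influence mu x = expm 1 x - 6^-1 - 4 / 3 * expm 3 x.
Proof.
move=> x0; rewrite /influence dom_probE// dom_projE// expr2 expmM.
have -> : 2^-1 + 2^-1 = 1 :> R by field.
by field.
Qed.

Lemma influence_mean : \int[mu]_x influence mu x = 0.
Proof.
have b1 : bounded_mfun (expm 1) by exact: bmfun_expm.
have b3 : bounded_mfun (expm 3) by exact: bmfun_expm.
have bc : bounded_mfun (fun _ : R => 6^-1 : R) by exact: bmfun_cst.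
have b3' : bounded_mfun (fun x => 4 / 3 * expm 3 x).
  by apply: bmfunM => //; exact: bmfun_cst.
rewrite (exp_eq_ge0 (bmfun_influence mu) (bmfunB (bmfunB b1 bc) b3') influenceE).
rewrite expB//; last exact: bmfunB.
rewrite expB// exp_cst expZ// !exp_expm//.
by field.
Qed.

(** Squaring gives a combination of [expm r], each of mean 1 / (1 + r): 1/3 + 16/63 - 8/15 + 1/9 -
    1/6 + 1/36 = 11/420. *)
Lemma influence_var : \int[mu]_x (influence mu x ^+ 2) = 9 * Delta2.
Proof.
have b r : 0 <= r -> bounded_mfun (expm r) by exact: bmfun_expm.
have bZ (c r : R) : 0 <= r -> bounded_mfun (fun x => c * expm r x).
  by move=> r0; apply: bmfunM; [exact: bmfun_cst|exact: bmfun_expm].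
transitivity (\int[mu]_x (1 * expm 2 x + (16 / 9 * expm 6 x + (- (8 / 3) * expm 4 x +
    (4 / 9 * expm 3 x + (- (1 / 3) * expm 1 x + 36^-1 * expm 0 x)))))).
  apply: exp_eq_ge0.
  - exact: bmfunX (bmfun_influence mu).
  - by repeat (apply: bmfunD; first exact: bZ); exact: bZ.
  move=> x x0; rewrite influenceE//.
  have -> : expm 0 x = 1 by rewrite /expm !mul0r oppr0 expR0.
  (* All exponentials become powers of [expm 1 x], so that the expansion of the square is a
     polynomial identity. *)
  have e r : expm (1 + r) x = expm 1 x * expm r x by rewrite expmM.
  have -> : expm 6 x = expm 1 x ^+ 6.
    by rewrite -[6]/(1 + (1 + (1 + (1 + (1 + 1))))) !e; ring.
  have -> : expm 4 x = expm 1 x ^+ 4.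
    by rewrite -[4]/(1 + (1 + (1 + 1))) !e; ring.
  have -> : expm 3 x = expm 1 x ^+ 3 by rewrite -[3]/(1 + (1 + 1)) !e; ring.
  have -> : expm 2 x = expm 1 x ^+ 2 by rewrite -[2]/(1 + 1) !e; ring.
  by field.
do 5 (rewrite expD; [|exact: bZ|by repeat (apply: bmfunD; first exact: bZ); exact: bZ]).
rewrite !expZ; try exact: b.
rewrite !exp_expm// /Delta2.
by field.
Qed.

End exponential.

Theorem theorem4 (d : measure_display) (T : measurableType d) (R : realType)
  (P : probability T R) (lam : R) (X : nat -> {RV P >-> R}) :
  0 < lam ->
  mutually_independent X ->
  (forall i, exp_distributed lam (X i)) ->
  conv_in_distribution P
    (fun n w => Num.sqrt (n%:R) * In (fun i => (X i : T -> R)) n w)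
    (normal_prob 0 (Num.sqrt (9%:R * Delta2))).
Proof.
move=> lam0 indepX expX.
(* The common law is taken as the distribution of [X 0], which carries the structure of a
   probability and agrees with [exponential_prob lam] on measurable sets. *)
pose mu : probability R R := distribution P (X 0%N).
have mu_exp A : measurable A -> mu A = exponential_prob lam A by exact: expX.
have lawX i A : measurable A -> P (X i @^-1` A) = mu A.
  by move=> mA; rewrite mu_exp//; exact: expX.
have D0 : 0 < 9%:R * Delta2 :> R by rewrite /Delta2 mulr_gt0 ?divr_gt0 ?ltr0n.
apply: (@conv_in_distribution_linearized _ _ _ _ _ mu (influence mu) X _ _ _ _ _ _
  _ 26).
- by rewrite sqrtr_gt0.
- exact: bmfun_influence.
- exact: (influence_mean lam0 mu_exp).
- by rewrite sqr_sqrtr ?(ltW D0)//; exact: (influence_var lam0 mu_exp).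
- exact: indepX.
- exact: lawX.
- by move=> n; apply: bmfunM; [exact: bmfun_cst|exact: bmfun_In].
- move=> n n1; apply: In_linearization => //.
  + exact: (dom_proj_mean lam0 mu_exp).
  + exact: (exponential_atomless mu_exp).
Qed.
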